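(* Let $\mathbb{F}$ be an algebraically closed field of characteristic $0$, $n\ge2$ an integer and $\kappa\in\mathbb{F}\setminus\{0\}$. Let $E$ and $F$ be finite-dimensional irreducible $\mathfrak{S}_n$-modules over $\mathbb{F}$. Then $$[\Delta_\kappa(E):\mathcal{L}_\kappa(F)]=[\widetilde{\Delta}_\kappa(E):\widetilde{\mathcal{L}}_\kappa(F)],$$ where $[M:N]$ denotes the multiplicity of the irreducible module $N$ in the composition series of $M$.
   Context: Notation: $\mathfrak{S}_n$ is the symmetric group, $s_{ij}$ the transposition of $i\ne j$, and $s_i=s_{i,i+1}$. Write $\mathbb{F}[\underline{x}]=\mathbb{F}[x_1,\dots,x_n]$, $\mathbb{F}[\underline{x}^{\pm1}]=\mathbb{F}[x_1^{\pm1},\dots,x_n^{\pm1}]$, $\mathbb{F}[\underline{y}]=\mathbb{F}[y_1,\dots,y_n]$, $\mathbb{F}[\underline{u}]=\mathbb{F}[u_1,\dots,u_n]$ (polynomial, resp. Laurent polynomial, rings). The group $\mathfrak{S}_n$ permutes the $x_i$, and $\rtimes$ denotes the smash product, so $wx_iw^{-1}=x_{w(i)}$. $\mathbf{H}_\kappa$ (rational Cherednik algebra of type $GL_n$) is the unital associative $\mathbb{F}$-algebra which is the quotient of the free product of the algebras $\mathbb{F}[\underline{x}]\rtimes\mathfrak{S}_n$ and $\mathbb{F}[\underline{y}]$ by the relations $s_iy_j=y_{s_i(j)}s_i$ ($1\le i\le n-1$, $1\le j\le n$); $[y_i,x_i]=\kappa+\sum_{k\ne i}s_{ik}$; $[y_i,x_j]=-s_{ij}$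 for $i\neq j$. $\widetilde{\mathbf{H}}_\kappa$ (degenerate double affine Hecke algebra of type $GL_n$) is the unital associative $\mathbb{F}$-algebra which is the quotient of the free product of the algebras $\mathbb{F}[\underline{x}^{\pm1}]\rtimes\mathfrak{S}_n$ and $\mathbb{F}[\underline{u}]$ by the relations $s_iu_i=u_{i+1}s_i-1$, $s_iu_{i+1}=u_is_i+1$ ($1\le i\le n-1$); $s_iu_j=u_js_i$ ($j\ne i,i+1$); $[u_i,x_i]=\kappa x_i+\sum_{1\le k<i}x_ks_{ki}+\sum_{i<k\le n}x_is_{ik}$; $[u_i,x_j]=-x_js_{ji}$ for $i>j$; $[u_i,x_j]=-x_is_{ij}$ for $i<j$. Standard modules. Let $\mathbf{H}_{\ge0}=\mathbb{F}\mathfrak{S}_n\cdot\mathbb{F}[\underline{y}]\subset\mathbf{H}_\kappa$ and let $\phi:\mathbf{H}_{\ge0}\to\mathbb{F}\mathfrak{S}_n$ be the algebra homomorphism with $\phi(s_i)=s_i$, $\phi(y_i)=0$. For a finite-dimensional $\mathfrak{S}_n$-module $E$, let ${}^\phi E$ be $E$ viewed as an $\mathbf{H}_{\ge0}$-module through $\phi$, and put $\Delta_\kappa(E)=\mathbf{H}_\kappa\otimes_{\mathbf{H}_{\ge0}}{}^\phi E$. Let $\mathbf{H}^{\rm aff}=\mathbb{F}\mathfrak{S}_n\cdot\mathbb{F}[\underline{u}]\subset\widetilde{\mathbf{H}}_\kappa$ and let $\psi:\mathbf{H}^{\rm aff}\to\mathbb{F}\mathfrak{S}_n$ be the algebra homomorphism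 with $\psi(s_i)=s_i$, $\psi(u_i)=\sum_{j<i}s_{ji}$. Let ${}^\psi E$ be $E$ viewed as an $\mathbf{H}^{\rm aff}$-module through $\psi$, and put $\widetilde{\Delta}_\kappa(E)=\widetilde{\mathbf{H}}_\kappa\otimes_{\mathbf{H}^{\rm aff}}{}^\psi E$. Standard modules have finite composition series. For $E$ a finite-dimensional irreducible $\mathfrak{S}_n$-module, $\Delta_\kappa(E)$ and $\widetilde{\Delta}_\kappa(E)$ each have a unique simple quotient module, denoted $\mathcal{L}_\kappa(E)$ and $\widetilde{\mathcal{L}}_\kappa(E)$ respectively. *)

(* Defs.v *)
From HB Require Import structures.
From mathcomp Require Import all_boot all_order all_fingroup all_algebra.
From mathcomp Require Import mxrepresentation boolp classical_sets monalg.

Set Implicit Arguments.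
Unset Strict Implicit.
Unset Printing Implicit Defensive.

Import GRing.Theory.
Local Open Scope ring_scope.
Local Open Scope quotient_scope.

Section QuotientModule.
Variables (A : pzRingType) (M : lmodType A) (N : submodClosed M).

(* [submodClosed] does not inherit from [zmodClosed] in the library, although
   over a ring every submodule is closed under opposites. *)
Definition submod_pred : {pred M} := N.

Fact submod_pred_closed : subsemimod_closed submod_pred.
Proof. exact: (GRing.subsemimodClosedP N). Qed.

HB.instance Definition _ := GRing.isSubmodClosed.Build A M submod_pred
  submod_pred_closed.

Definition quot_mod : Type := Quotient.quot submod_pred.
HB.instance Definition _ := GRing.Zmodule.on quot_mod.
HB.instance Definition _ := EqQuotient.on quot_mod.

Definition quot_proj (x : M) : quot_mod := \pi_(quot_mod) x.

Lemma quot_projP x y : quot_proj x = quot_proj y <-> x - y \in N.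
Proof.
rewrite -[_ \in N]/(x - y \in submod_pred).
by rewrite -Quotient.equivE; split=> [/eqP | ?]; [|apply/eqP]; rewrite piE.
Qed.

Lemma quot_proj_surj u : exists x, u = quot_proj x.
Proof. by exists (generic_quotient.repr u); rewrite /quot_proj reprK. Qed.

Definition quot_scale (a : A) (u : quot_mod) : quot_mod :=
  quot_proj (a *: generic_quotient.repr u).

Fact quot_projB : zmod_morphism quot_proj.
Proof. by move=> x y; rewrite /quot_proj !piE. Qed.

HB.instance Definition _ :=
  GRing.isZmodMorphism.Build M quot_mod quot_proj quot_projB.

Fact quot_projZ a x : quot_proj (a *: x) = quot_scale a (quot_proj x).
Proof.
apply/quot_projP; rewrite -scalerBr; apply: rpredZ.
by apply/quot_projP; rewrite /quot_proj reprK.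
Qed.

Fact quot_scaleA a b u : quot_scale a (quot_scale b u) = quot_scale (a * b) u.
Proof. by have [x ->] := quot_proj_surj u; rewrite -!quot_projZ scalerA. Qed.

Fact quot_scale1 : left_id 1 quot_scale.
Proof.
by move=> u; have [x ->] := quot_proj_surj u; rewrite -!quot_projZ scale1r.
Qed.

Fact quot_scaleDr : right_distributive quot_scale +%R.
Proof.
move=> a u v; have [x ->] := quot_proj_surj u; have [y ->] := quot_proj_surj v.
by rewrite -!quot_projZ -!(raddfD quot_proj) -quot_projZ scalerDr.
Qed.

Fact quot_scaleDl u : {morph quot_scale^~ u : a b / a + b}.
Proof.
move=> a b; have [x ->] := quot_proj_surj u.
by rewrite -!quot_projZ -(raddfD quot_proj) scalerDl.
Qed.

HB.instance Definition _ := GRing.Zmodule_isLmodule.Build A quot_mod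
  quot_scaleA quot_scale1 quot_scaleDr quot_scaleDl.

HB.instance Definition _ :=
  GRing.isScalable.Build A M quot_mod *:%R quot_proj quot_projZ.

Definition sub_mod : Type := {x : M | x \in N}.
HB.instance Definition _ := SubChoice.on sub_mod.
HB.instance Definition _ :=
  GRing.SubChoice_isSubLmodule.Build A M (mem N) sub_mod submod_pred_closed.

End QuotientModule.

Section SpannedSubmodule.
Variables (A : pzRingType) (M : lmodType A) (X : M -> Prop).

Inductive in_span : M -> Prop :=
| in_span0 : in_span 0
| in_spanS a x y : X x -> in_span y -> in_span (a *: x + y).

Definition span_mod : {pred M} := fun x => `[< in_span x >].

Fact span_mod_closed : subsemimod_closed span_mod.
Proof.
have addP x y : in_span x -> in_span y -> in_span (x + y).
  move=> + spy; elim=> [|a u v Xu _ IH]; first by rewrite add0r.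
  by rewrite -addrA; constructor.
split=> [|a x /asboolP spx]; first split.
- by apply/asboolP; constructor.
- by move=> x y /asboolP spx /asboolP spy; apply/asboolP/addP.
apply/asboolP; elim: spx => [|b u v Xu _ IH].
  by rewrite scaler0; constructor.
by rewrite scalerDr scalerA; constructor.
Qed.

HB.instance Definition _ := GRing.isSubSemiModClosed.Build A M span_mod
  span_mod_closed.

End SpannedSubmodule.

Section SubQuotient.
Variables (A : pzRingType) (M : lmodType A) (N P : submodClosed M).

Definition trace_mod : {pred sub_mod P} := fun u => val u \in N.

Fact trace_mod_closed : subsemimod_closed trace_mod.
Proof.
split=> [|a u Nu]; first split.
- exact: (rpred0 N).
- by move=> u v Nu Nv; apply: (rpredD (S := N)).
exact: (rpredZ (s := N)) Nu.
Qed.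

HB.instance Definition _ := GRing.isSubSemiModClosed.Build A (sub_mod P)
  trace_mod trace_mod_closed.

(* P / (N :&: P), i.e. P / N when N is contained in P. *)
Definition subquot_mod : lmodType A := quot_mod trace_mod.

End SubQuotient.

Section Multiplicity.
Variable A : pzRingType.
Implicit Types M L : lmodType A.

Definition simple_mod L : Prop :=
  (exists x : L, x != 0) /\
  forall N : submodClosed L, (forall x, x \in N -> x = 0) \/ (forall x, x \in N).

Definition iso_mod M L : Prop := exists f : {linear M -> L}, bijective f.

Definition simple_quotient M L : Prop :=
  simple_mod L /\ exists f : {linear M -> L}, forall y, exists x, f x = y.

Definition composition_series M (l : nat) (S : nat -> submodClosed M) : Prop :=
  [/\ forall x, (x \in S 0) = (x == 0),
      forall x, x \in S l &
      forall i, (i < l)%N ->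
        {subset S i <= S i.+1} /\ simple_mod (subquot_mod (S i) (S i.+1))].

Definition count_factors M L (l : nat) (S : nat -> submodClosed M) : nat :=
  \sum_(i < l) `[< iso_mod (subquot_mod (S i) (S i.+1)) L >].

(* [M : L]; by Jordan-Hölder the set below has at most one element, and it is
   empty exactly when M has no finite composition series. *)
Definition multiplicity M L : nat :=
  xget 0%N [set m | exists l S, composition_series l S /\
                                m = @count_factors M L l S].

End Multiplicity.

(* The free algebra on G, as the monoid algebra of the free monoid on G. *)
Notation free_alg F G := {malg F[{fmonom G}]}.

Section Presentation.
Variables (F : fieldType) (G : choiceType).
Local Notation free_alg := (free_alg F G).

Definition free_gen (g : G) : free_alg := << FMonom [:: g] >>.

Variable R : free_alg -> free_alg -> Prop.

Inductive in_ideal : free_alg -> Prop :=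
| in_ideal0 : in_ideal 0
| in_idealS a b p q x :
    R p q -> in_ideal x -> in_ideal (a * (p - q) * b + x).

Definition rel_ideal : {pred free_alg} := fun x => `[< in_ideal x >].

Fact free_alg_scalerAr (c : F) (x y : free_alg) : c *: (x * y) = x * (c *: y).
Proof.
pose k1 : free_alg := << c *g @mone {fmonom G} >>.
have scl (z : free_alg) : c *: z = k1 * z.
  by rewrite -mul_malgC.
suff scr (z : free_alg) : c *: z = z * k1.
  by rewrite !scr mulrA.
rewrite scl [LHS]fgmulUg [RHS]fgmulgU; apply: eq_bigr => k _.
by rewrite mulrC mul1m mulm1.
Qed.

Fact in_idealD x y : in_ideal x -> in_ideal y -> in_ideal (x + y).
Proof.
move=> + idy; elim=> [|a b p q u Rpq _ IH]; first by rewrite add0r.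
by rewrite -addrA; constructor.
Qed.

Fact in_idealMl c x : in_ideal x -> in_ideal (c * x).
Proof.
elim=> [|a b p q u Rpq _ IH]; first by rewrite mulr0; constructor.
by rewrite mulrDr !mulrA; apply: in_idealS.
Qed.

Fact in_idealMr c x : in_ideal x -> in_ideal (x * c).
Proof.
elim=> [|a b p q u Rpq _ IH]; first by rewrite mul0r; constructor.
by rewrite mulrDl -(mulrA _ b); apply: in_idealS.
Qed.

Fact rel_ideal_closed : subsemimod_closed rel_ideal.
Proof.
split=> [|c x /asboolP idx]; first split.
- by apply/asboolP; constructor.
- by move=> x y /asboolP idx /asboolP idy; apply/asboolP/in_idealD.
by apply/asboolP; rewrite -[x]mul1r scalerAl; apply: in_idealMl.
Qed.

HB.instance Definition _ := GRing.isSubSemiModClosed.Build F free_alg rel_ideal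
  rel_ideal_closed.

(* F<G> / (p - q | R p q).  The ring structure is a [pzRingType]: non-triviality
   of a presented algebra depends on the relations, so that [algType] is not
   available here; [pres_scalerAl] and [pres_scalerAr] are its axioms. *)
Definition pres_alg : Type := quot_mod rel_ideal.
HB.instance Definition _ := GRing.Lmodule.on pres_alg.

Definition pres_proj (x : free_alg) : pres_alg := quot_proj rel_ideal x.

Fact pres_projB : zmod_morphism pres_proj.
Proof. exact: quot_projB. Qed.

HB.instance Definition _ :=
  GRing.isZmodMorphism.Build free_alg pres_alg pres_proj pres_projB.

Fact pres_projZ : scalable pres_proj.
Proof. exact: quot_projZ. Qed.

HB.instance Definition _ :=
  GRing.isScalable.Build F free_alg pres_alg *:%R pres_proj pres_projZ.

Lemma pres_projP x y : pres_proj x = pres_proj y <-> in_ideal (x - y).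
Proof.
by split=> [/quot_projP/asboolP | ?]; [|apply/quot_projP/asboolP].
Qed.

Lemma pres_proj_surj u : exists x, u = pres_proj x.
Proof. exact: quot_proj_surj. Qed.

Definition pres_one : pres_alg := pres_proj 1.
Definition pres_mul (u v : pres_alg) : pres_alg :=
  pres_proj (generic_quotient.repr u * generic_quotient.repr v).

Fact pres_projM x y : pres_proj (x * y) = pres_mul (pres_proj x) (pres_proj y).
Proof.
have reprP z : in_ideal (z - generic_quotient.repr (pres_proj z)).
  by apply/pres_projP; rewrite /pres_proj /quot_proj reprK.
apply/pres_projP.
set x' := generic_quotient.repr _; set y' := generic_quotient.repr _.
have -> : x * y - x' * y' = (x - x') * y + x' * (y - y').
  by rewrite mulrBl mulrBr addrA subrK.
by apply: in_idealD; [apply: in_idealMr | apply: in_idealMl]; apply: reprP.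
Qed.

Fact pres_mulA : associative pres_mul.
Proof.
move=> u v w; have [x ->] := pres_proj_surj u; have [y ->] := pres_proj_surj v.
by have [z ->] := pres_proj_surj w; rewrite -!pres_projM mulrA.
Qed.

Fact pres_mul1l : left_id pres_one pres_mul.
Proof.
by move=> u; have [x ->] := pres_proj_surj u; rewrite -pres_projM mul1r.
Qed.

Fact pres_mul1r : right_id pres_one pres_mul.
Proof.
by move=> u; have [x ->] := pres_proj_surj u; rewrite -pres_projM mulr1.
Qed.

Fact pres_mulDl : left_distributive pres_mul +%R.
Proof.
move=> u v w; have [x ->] := pres_proj_surj u; have [y ->] := pres_proj_surj v.
have [z ->] := pres_proj_surj w.
by rewrite -raddfD -!pres_projM -raddfD mulrDl.
Qed.

Fact pres_mulDr : right_distributive pres_mul +%R.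
Proof.
move=> u v w; have [x ->] := pres_proj_surj u; have [y ->] := pres_proj_surj v.
have [z ->] := pres_proj_surj w.
by rewrite -raddfD -!pres_projM -raddfD mulrDr.
Qed.

HB.instance Definition _ := GRing.Zmodule_isPzRing.Build pres_alg
  pres_mulA pres_mul1l pres_mul1r pres_mulDl pres_mulDr.

Fact pres_proj_monoid : monoid_morphism pres_proj.
Proof. by split=> // x y; apply: pres_projM. Qed.

HB.instance Definition _ :=
  GRing.isMonoidMorphism.Build free_alg pres_alg pres_proj pres_proj_monoid.

Lemma pres_scalerAl (c : F) (u v : pres_alg) : c *: (u * v) = (c *: u) * v.
Proof.
have [x ->] := pres_proj_surj u; have [y ->] := pres_proj_surj v.
by rewrite -rmorphM -!linearZ -rmorphM scalerAl.
Qed.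

Lemma pres_scalerAr (c : F) (u v : pres_alg) : c *: (u * v) = u * (c *: v).
Proof.
have [x ->] := pres_proj_surj u; have [y ->] := pres_proj_surj v.
by rewrite -rmorphM -!linearZ -rmorphM free_alg_scalerAr.
Qed.

Definition pres_gen (g : G) : pres_alg := pres_proj (free_gen g).

End Presentation.

Definition commutator (A : pzRingType) (a b : A) : A := a * b - b * a.

(* Conventions for the symmetric group.  The product of ['S_n] is
   (u * v) i = v (u i), so the usual composite "v after u" is (u * v)%g.
   A left module over the usual symmetric group is therefore the
   same as a representation of ['S_n] in the sense of [mx_representation],
   w acting on a row vector by v |-> v *m rG w. *)

Section RationalCherednik.
Variables (F : fieldType) (n : nat) (kappa : F).

Inductive rat_index := RatX of 'I_n | RatW of 'S_n | RatY of 'I_n.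

HB.instance Definition _ := gen_eqMixin rat_index.
HB.instance Definition _ := gen_choiceMixin rat_index.

Notation A := (free_alg F rat_index).
Let x i : A := free_gen F (RatX i).
Let w s : A := free_gen F (RatW s).
Let y i : A := free_gen F (RatY i).
Let t i j : A := w (tperm i j).

(* The free product of F[x] >< S_n and F[y] modulo the cross relations is
   presented by the generators and relations of both factors (rat_xx to rat_wx
   and rat_yy) together with the cross relations. *)
Inductive rat_rel : A -> A -> Prop :=
| rat_xx i j : rat_rel (x i * x j) (x j * x i)
| rat_w1 : rat_rel (w 1%g) 1
| rat_ww u v : rat_rel (w v * w u) (w (u * v)%g)
| rat_wx s i : rat_rel (w s * x i * w s^-1%g) (x (s i))
| rat_yy i j : rat_rel (y i * y j) (y j * y i)
| rat_sy (i i' j : 'I_n) of i' = i.+1 :> nat :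
    rat_rel (t i i' * y j) (y (tperm i i' j) * t i i')
| rat_yx i :
    rat_rel (commutator (y i) (x i)) (kappa%:A + \sum_(k | k != i) t i k)
| rat_yx' i j of i != j : rat_rel (commutator (y i) (x j)) (- t i j).

Definition rat_cherednik : Type := pres_alg rat_rel.
HB.instance Definition _ := GRing.PzRing.on rat_cherednik.
HB.instance Definition _ := GRing.Lmodule.on rat_cherednik.

Definition rat_gen (g : rat_index) : rat_cherednik := pres_gen rat_rel g.

End RationalCherednik.

Section TrigCherednik.
Variables (F : fieldType) (n : nat) (kappa : F).

(* TrigXV i is the inverse of the i-th variable x. *)
Inductive trig_index :=
  TrigX of 'I_n | TrigXV of 'I_n | TrigW of 'S_n | TrigU of 'I_n.

HB.instance Definition _ := gen_eqMixin trig_index.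
HB.instance Definition _ := gen_choiceMixin trig_index.

Notation A := (free_alg F trig_index).
Let x i : A := free_gen F (TrigX i).
Let xV i : A := free_gen F (TrigXV i).
Let w s : A := free_gen F (TrigW s).
Let u i : A := free_gen F (TrigU i).
Let t i j : A := w (tperm i j).

(* Same encoding: trig_xx to trig_wx present F[x^{+-1}] >< S_n and trig_uu
   presents F[u].  That the xV commute with each other and with the x, and are
   permuted by S_n, follows by inverting the relations for x. *)
Inductive trig_rel : A -> A -> Prop :=
| trig_xx i j : trig_rel (x i * x j) (x j * x i)
| trig_xxV i : trig_rel (x i * xV i) 1
| trig_xVx i : trig_rel (xV i * x i) 1
| trig_w1 : trig_rel (w 1%g) 1
| trig_ww s s' : trig_rel (w s' * w s) (w (s * s')%g)
| trig_wx s i : trig_rel (w s * x i * w s^-1%g) (x (s i))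
| trig_uu i j : trig_rel (u i * u j) (u j * u i)
| trig_su (i i' : 'I_n) of i' = i.+1 :> nat :
    trig_rel (t i i' * u i) (u i' * t i i' - 1)
| trig_su' (i i' : 'I_n) of i' = i.+1 :> nat :
    trig_rel (t i i' * u i') (u i * t i i' + 1)
| trig_su'' (i i' j : 'I_n) of i' = i.+1 :> nat & j != i & j != i' :
    trig_rel (t i i' * u j) (u j * t i i')
| trig_ux i :
    trig_rel (commutator (u i) (x i))
      (kappa *: x i + \sum_(k : 'I_n | (k < i)%N) x k * t k i
                    + \sum_(k : 'I_n | (i < k)%N) x i * t i k)
| trig_ux_gt (i j : 'I_n) of (j < i)%N :
    trig_rel (commutator (u i) (x j)) (- (x j * t j i))
| trig_ux_lt (i j : 'I_n) of (i < j)%N :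
    trig_rel (commutator (u i) (x j)) (- (x i * t i j)).

Definition trig_cherednik : Type := pres_alg trig_rel.
HB.instance Definition _ := GRing.PzRing.on trig_cherednik.
HB.instance Definition _ := GRing.Lmodule.on trig_cherednik.

Definition trig_gen (g : trig_index) : trig_cherednik := pres_gen trig_rel g.

End TrigCherednik.

Section Induction.
Variables (F : fieldType) (n : nat) (G : choiceType).
Variable R : free_alg F G -> free_alg F G -> Prop.

Local Notation H := (pres_alg R).
Local Notation FS := 'M[F]_#|[set: 'S_n]|.

(* Graph of the algebra homomorphism f from a subalgebra B of H to the group
   algebra of S_n that is prescribed by [gens] on generators of B: it is the
   subalgebra of H x F[S_n] generated by [gens], and B is its projection to H.
   The group algebra is the library's [group_ring F [set: 'S_n]], spanned by
   the matrices [regular_repr F [set: 'S_n] w]; since the product of ['S_n] is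
   opposite to composition, multiplication is reversed there. *)
Inductive hom_graph (gens : H -> FS -> Prop) : H -> FS -> Prop :=
| hom_gen b a of gens b a : hom_graph gens b a
| hom_scalar (c : F) : hom_graph gens (c *: (1 : H)) c%:M
| hom_add b b' a a' of hom_graph gens b a & hom_graph gens b' a' :
    hom_graph gens (b + b') (a + a')
| hom_mul b b' a a' of hom_graph gens b a & hom_graph gens b' a' :
    hom_graph gens (b * b') (a' *m a).

Variables (d : nat) (rE : mx_representation F [set: 'S_n] d).

(* The vector h (x) v of H (x)_F E, where H (x)_F F^d is identified with H^d. *)
Definition tensor (h : H) (v : 'rV[F]_d) : 'rV[H]_d := \row_j (v 0 j *: h).

Variable f : H -> FS -> Prop.

Inductive tensor_rel : 'rV[H]_d -> Prop :=
| TensorRel h b a v of f b a :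
    tensor_rel (tensor (h * b) v - tensor h (v *m gring_op rE a)).

(* H (x)_B E, where B, the domain of f, acts on E through f : B -> F[S_n].
   Right multiplication by b in B is balanced against its action on E; the
   scalars of F are already balanced in H (x)_F E. *)
Definition induced_mod : lmodType H := quot_mod (span_mod tensor_rel).

End Induction.

Section StandardModules.
Variables (F : fieldType) (n : nat) (kappa : F).
Variables (d : nat) (rE : mx_representation F [set: 'S_n] d).

Local Notation aS := (regular_repr F [set: 'S_n]).

(* The subalgebra F S_n . F[y] is generated by S_n and the y's, and similarly
   F S_n . F[u] by S_n and the u's. *)
Inductive phi_gen :
    rat_cherednik n kappa -> 'M[F]_#|[set: 'S_n]| -> Prop :=
| phi_w s : phi_gen (rat_gen kappa (RatW s)) (aS s)
| phi_y i : phi_gen (rat_gen kappa (RatY i)) 0.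

Inductive psi_gen :
    trig_cherednik n kappa -> 'M[F]_#|[set: 'S_n]| -> Prop :=
| psi_w s : psi_gen (trig_gen kappa (TrigW s)) (aS s)
| psi_u i : psi_gen (trig_gen kappa (TrigU i))
    (\sum_(j : 'I_n | (j < i)%N) aS (tperm j i)).

Definition rat_standard : lmodType (rat_cherednik n kappa) :=
  induced_mod rE (hom_graph phi_gen).

Definition trig_standard : lmodType (trig_cherednik n kappa) :=
  induced_mod rE (hom_graph psi_gen).

End StandardModules.

(* Main.v *)
Require Import Defs.
From HB Require Import structures.
From mathcomp Require Import all_boot all_order all_fingroup all_algebra.
From mathcomp Require Import mxrepresentation boolp classical_sets monalg.
From mathcomp Require Import functions.

Set Implicit Arguments.
Unset Strict Implicit.
Unset Printing Implicit Defensive.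

Import GRing.Theory.
Local Open Scope ring_scope.

(* the commutator a b - b a of a ring, not that of a group *)
Local Notation commutator := Defs.commutator.

(** The idea is Suzuki's: the trigonometric algebra Ht is a localization of the
    rational algebra H.  With A_i = \sum_(k < i) s_ki the i-th Jucys-Murphy
    element, u_i = x_i y_i + A_i satisfies in H all relations of Ht that do not
    mention inverses ([rU_sys]); conversely y_i = x_i^-1 (u_i - A_i) satisfies
    in Ht the relations of H ([tY_sys]).  Hence there is a morphism iota from H
    to Ht, and since p = x_1 ... x_n satisfies p u_i = (u_i - kappa) p, every
    element of Ht is a left fraction with denominator a power of p
    ([ore_iota]).

    Let Y = y_1 + ... + y_n.  As [Y, x_i] = kappa is invertible, Y acts as a
    derivation in each x_i, and by differentiating, a vector v killed by a
    power of Y belongs to any H-stable subgroup N containing some p^k v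
    ([saturating_xfull]).  On modules where Y is locally nilpotent this makes
    localization lossless: p acts injectively on the module and on all its
    quotients, M and M[1/p] have the same lattice of submodules, and M is
    recovered from M[1/p] as the vectors killed by a power of Y.  Composition
    series of M and M[1/p] therefore correspond, with the same isomorphisms
    between their factors ([ore_multiplicity]).

    It remains to see the two standard modules as such a pair, and likewise the
    two simple quotients.
    - Y lowers the degree in x on Delta(E), hence is locally nilpotent.  By
      universality Delta(E) maps to the trigonometric standard module, and the
      only difficulty is injectivity: an Ht-module containing Delta(E) is
      needed.  It is constructed as a module of germs at infinity of sequences,
      a vector v of Delta(E)[1/p] being encoded by the sequence p^k v, which
      lies in Delta(E) for k large ([ex_localization]).
    - For simple quotients one needs that Delta(E') has a single maximal
      submodule: the Euler element u_1 + ... + u_n acts on the part of degree m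
      as kappa m + constant, by Schur's lemma, so that submodules are graded,
      and a proper one does not meet the irreducible part of degree 0
      ([sum_proper]).  The localization of the maximal submodule is then the
      kernel of the simple quotient on the trigonometric side
      ([ore_simple_quotient]). *)

(** * Jucys-Murphy elements *)

(** The relations between the symmetric group and the y's or u's are given for
    simple transpositions only; this principle extends them to all of it. *)
Lemma perm_adj_ind n (P : 'S_n -> Prop) :
  P 1%g -> (forall s s', P s -> P s' -> P (s * s')%g) ->
  (forall i i' : 'I_n, i' = i.+1 :> nat -> P (tperm i i')) -> forall s, P s.
Proof.
move=> P1 PM Padj.
have Plt : forall d (i j : 'I_n), j = (i + d.+1)%N :> nat -> P (tperm i j).
  elim=> [|d IH] i j ji; first by apply: Padj; rewrite ji addn1.
  have lt_j' : (i + d.+1 < n)%N.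
    by apply: leq_trans (ltn_ord j); rewrite ji [in leqRHS]addnS ltnS.
  pose j' := Ordinal lt_j'.
  have jj' : j = j'.+1 :> nat by rewrite ji addnS.
  have -> : tperm i j = (tperm j' j * tperm i j' * tperm j' j)%g.
    rewrite -[X in (X * _ * _)%g]tpermV -mulgA -conjgE tpermJ tpermL tpermD //.
      by rewrite -val_eqE /= neq_ltn addnS ltnS leq_addr orbT.
    by rewrite -val_eqE /= ji neq_ltn addnS ltnS leq_addr orbT.
  by apply: (PM); [apply: (PM); [apply: (Padj) | apply: IH] | apply: Padj].
have Pt (i j : 'I_n) : P (tperm i j).
  have [lt_ij|lt_ji|/val_inj ->] := ltngtP i j; last by rewrite tperm1.
    by apply: (Plt (j - i.+1)%N); rewrite -addSnnS subnKC.
  by rewrite tpermC; apply: (Plt (i - j.+1)%N); rewrite -addSnnS subnKC.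
move=> s; have [ts -> _] := prod_tpermP s.
by elim: ts => [|t ts IH]; rewrite ?big_nil ?big_cons //; apply: PM.
Qed.

Section SymmetricGroupElements.
Variables (B : pzRingType) (n : nat) (w : 'S_n -> B).
Hypotheses (w1 : w 1%g = 1) (wM : forall u v, w v * w u = w (u * v)%g).
Local Notation t i j := (w (tperm i j)).

Lemma wVw s : w s^-1%g * w s = 1. Proof. by rewrite wM mulgV. Qed.

Lemma w_tK i j : t i j * t i j = 1. Proof. by rewrite wM tperm2. Qed.

Lemma w_tJ (s : 'S_n) i j : w s * t i j = t (s i) (s j) * w s.
Proof. by rewrite !wM -tpermJ conjgE mulgA mulgA mulgV mul1g. Qed.

Lemma t_mulLR i j a b : a = t i j * b -> t i j * a = b.
Proof. by move->; rewrite mulrA w_tK mul1r. Qed.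

Definition jm (i : 'I_n) : B := \sum_(k : 'I_n | (k < i)%N) t k i.

(** A permutation that fixes j and preserves the numbers below j permutes the
    terms of the j-th Jucys-Murphy element. *)
Lemma jm_fix (s : 'S_n) (j : 'I_n) : s j = j ->
  (forall k : 'I_n, (s k < j)%N = (k < j)%N) -> w s * jm j = jm j * w s.
Proof.
move=> sj slt; rewrite mulr_sumr mulr_suml [RHS](reindex_inj (@perm_inj _ s)) /=.
by apply: eq_big => [k|k _]; rewrite ?slt // w_tJ sj.
Qed.

Lemma tperm_lt (i j k l : 'I_n) :
  (i < j)%N -> (k < j)%N -> (tperm i k l < j)%N = (l < j)%N.
Proof. by move=> ij kj; case: tpermP => [->|->|]; rewrite ?ij ?kj. Qed.

Lemma jm_t_lt (i j k : 'I_n) :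
  (i < j)%N -> (k < j)%N -> t i k * jm j = jm j * t i k.
Proof.
move=> ij kj; apply: jm_fix => [|l]; last exact: tperm_lt.
by rewrite tpermD // -val_eqE neq_ltn ?ij ?kj.
Qed.

Lemma jm_t_gt (i j k : 'I_n) :
  (j < i)%N -> (j < k)%N -> t i k * jm j = jm j * t i k.
Proof.
move=> ij kj; apply: jm_fix => [|l].
  by rewrite tpermD // -val_eqE neq_ltn ?ij ?kj ?orbT.
have geF (m : 'I_n) : (j < m)%N -> (m < j)%N = false by move=> jm; rewrite ltnNge ltnW.
by case: tpermP => [->|->|] //; rewrite !geF.
Qed.

Lemma jm_comm i j : jm i * jm j = jm j * jm i.
Proof.
wlog ij : i j / (i < j)%N => [hw|].
  by have [/hw|/hw|/val_inj ->] := ltngtP i j.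
rewrite {1 4}/jm mulr_suml mulr_sumr; apply: eq_bigr => k ki.
by apply: jm_t_lt => //; apply: ltn_trans ij.
Qed.

Lemma jm_adj (i i' : 'I_n) : i' = i.+1 :> nat ->
  jm i' = \sum_(k : 'I_n | (k < i)%N) t k i' + t i i'.
Proof.
move=> ii'; rewrite /jm (bigD1 i) ?ii' //= addrC; congr (_ + _).
by apply: eq_bigl => k; rewrite ltnS -val_eqE ltn_neqAle andbC.
Qed.

(** The Jucys-Murphy elements satisfy the relations of the u's with the simple
    transpositions: they are the images of the u's under the evaluation of the
    degenerate affine Hecke algebra in the group algebra. *)
Lemma jm_su (i i' : 'I_n) : i' = i.+1 :> nat -> t i i' * jm i = jm i' * t i i' - 1.
Proof.
move=> ii'; rewrite (jm_adj ii') mulrDl w_tK addrK mulr_sumr mulr_suml.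
apply: eq_bigr => k ki; rewrite w_tJ tpermL tpermD //.
  by rewrite -val_eqE neq_ltn ki orbT.
by rewrite -val_eqE /= neq_ltn ii' ltnS (ltnW ki) orbT.
Qed.

Lemma jm_su' (i i' : 'I_n) : i' = i.+1 :> nat -> t i i' * jm i' = jm i * t i i' + 1.
Proof.
move=> ii'; apply: t_mulLR; rewrite mulrDr mulr1 mulrA (jm_su ii').
by rewrite mulrBl mul1r -mulrA w_tK mulr1 subrK.
Qed.

Lemma jm_su'' (i i' j : 'I_n) : i' = i.+1 :> nat -> j != i -> j != i' ->
  t i i' * jm j = jm j * t i i'.
Proof.
rewrite -!val_eqE /= => ii' ji ji'.
have [lt_ji|le_ij] := ltnP j i; first by apply: jm_t_gt => //; rewrite ii' ltnW.
have ij : (i < j)%N by rewrite ltn_neqAle eq_sym ji.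
by apply: jm_t_lt => //; rewrite ltn_neqAle eq_sym ji' ii'.
Qed.

End SymmetricGroupElements.

(** * The relations of the two algebras in an arbitrary ring *)
Section Commutators.
Variable B : pzRingType.
Implicit Types a b c : B.
Lemma commutatorDl a b c : commutator (a + b) c = commutator a c + commutator b c.
Proof. by rewrite /commutator mulrDl mulrDr opprD addrACA. Qed.
Lemma commutatorDr a b c : commutator c (a + b) = commutator c a + commutator c b.
Proof. by rewrite /commutator mulrDl mulrDr opprD addrACA. Qed.
Lemma commutator_eq0 a b : a * b = b * a -> commutator a b = 0.
Proof. by rewrite /commutator => ->; rewrite subrr. Qed.
Lemma commutatorN a b : commutator b a = - commutator a b.
Proof. by rewrite /commutator opprB. Qed.
Lemma commutator_suml (I : finType) (P : pred I) (f : I -> B) c :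
  commutator (\sum_(i | P i) f i) c = \sum_(i | P i) commutator (f i) c.
Proof. by rewrite /commutator mulr_suml mulr_sumr -sumrB. Qed.
Lemma commutator_eq a b c : commutator a b = c -> a * b = b * a + c.
Proof. by rewrite /commutator => <-; rewrite addrC subrK. Qed.
End Commutators.

Section Systems.
Variables (B : pzRingType) (n : nat) (kap : B).
Implicit Types (x xV y z u : 'I_n -> B) (w : 'S_n -> B).
Local Notation t w i j := (w (tperm i j)).

Record smash_sys x w : Prop := SmashSys {
  smash_xx : forall i j, x i * x j = x j * x i;
  smash_w1 : w 1%g = 1;
  smash_ww : forall a b, w b * w a = w (a * b)%g;
  smash_wx : forall (s : 'S_n) i, w s * x i * w s^-1%g = x (s i) }.

Record rat_sys x w y : Prop := RatSys {
  rat_base : smash_sys x w;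
  ratS_yy : forall i j, y i * y j = y j * y i;
  ratS_sy : forall i i' j : 'I_n, i' = i.+1 :> nat ->
    t w i i' * y j = y (tperm i i' j) * t w i i';
  ratS_yx : forall i,
    commutator (y i) (x i) = kap + \sum_(k | k != i) t w i k;
  ratS_yx' : forall i j, i != j -> commutator (y i) (x j) = - t w i j }.

Record trig_sys x w u : Prop := TrigSys {
  trig_base : smash_sys x w;
  trigS_uu : forall i j, u i * u j = u j * u i;
  trigS_su : forall i i' : 'I_n, i' = i.+1 :> nat ->
    t w i i' * u i = u i' * t w i i' - 1;
  trigS_su' : forall i i' : 'I_n, i' = i.+1 :> nat ->
    t w i i' * u i' = u i * t w i i' + 1;
  trigS_su'' : forall i i' j : 'I_n, i' = i.+1 :> nat -> j != i -> j != i' ->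
    t w i i' * u j = u j * t w i i';
  trigS_ux : forall i, commutator (u i) (x i) =
    kap * x i + \sum_(k : 'I_n | (k < i)%N) x k * t w k i
              + \sum_(k : 'I_n | (i < k)%N) x i * t w i k;
  trigS_ux_gt : forall i j : 'I_n, (j < i)%N ->
    commutator (u i) (x j) = - (x j * t w j i);
  trigS_ux_lt : forall i j : 'I_n, (i < j)%N ->
    commutator (u i) (x j) = - (x i * t w i j) }.

(** The relations of z_i = x_i y_i = u_i - jm i.  They are the meeting point of
    the two presentations: z is conjugated by the symmetric group as x is, and
    no order on the indices is involved. *)
Record z_sys x w z : Prop := ZSys {
  z_base : smash_sys x w;
  zS_wz : forall (s : 'S_n) j, w s * z j = z (s j) * w s;
  zS_zx : forall i, commutator (z i) (x i) =
    kap * x i + \sum_(k | k != i) x i * t w i k;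
  zS_zx' : forall i j, i != j -> commutator (z i) (x j) = - (x i * t w i j);
  zS_zz : forall i j, i != j ->
    commutator (z i) (z j) = (z j - z i) * t w i j }.

Section Base.
Variables (x : 'I_n -> B) (w : 'S_n -> B).
Hypothesis bs : smash_sys x w.
Let w1 := smash_w1 bs.
Let wM := smash_ww bs.
Local Notation t i j := (w (tperm i j)).
Local Notation jm := (jm w).

Definition equivariant (v : 'I_n -> B) :=
  forall (s : 'S_n) j, w s * v j = v (s j) * w s.

Lemma equivariant_x : equivariant x.
Proof. by move=> s i; rewrite -(smash_wx bs) -!mulrA (wVw w1 wM) mulr1. Qed.

Lemma equivariant_adj (v : 'I_n -> B) :
  (forall (i i' j : 'I_n), i' = i.+1 :> nat ->
    t i i' * v j = v (tperm i i' j) * t i i') ->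
  equivariant v.
Proof.
move=> adj; apply: perm_adj_ind => [j|a b Ha Hb j|i i' ii' j].
- by rewrite w1 perm1 mul1r mulr1.
- by rewrite -wM -mulrA Ha !mulrA Hb permM.
exact: adj.
Qed.

Variable v : 'I_n -> B.
Hypothesis eqv : equivariant v.

Lemma jm_v i : jm i * v i = \sum_(k : 'I_n | (k < i)%N) v k * t k i.
Proof. by rewrite mulr_suml; apply: eq_bigr => k _; rewrite eqv tpermR. Qed.

Lemma jm_v_gt (i j : 'I_n) : (i < j)%N -> commutator (jm i) (v j) = 0.
Proof.
move=> ij; apply: commutator_eq0; rewrite mulr_suml mulr_sumr.
apply: eq_bigr => k ki.
by rewrite eqv tpermD // -val_eqE neq_ltn ?(ltn_trans ki ij) ?ij.
Qed.

Lemma jm_v_lt (i j : 'I_n) : (j < i)%N ->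
  commutator (jm i) (v j) = (v i - v j) * t j i.
Proof.
move=> ji; rewrite commutator_suml (bigD1 j) //= big1 => [|k /andP[ki kj]].
  by rewrite addr0 /commutator eqv tpermL mulrBl.
apply: commutator_eq0.
by rewrite eqv tpermD // -val_eqE neq_ltn ji orbT.
Qed.

End Base.

(** Passing between z and u = z + jm: each relation of one family is equivalent
    to the corresponding relation of the other one, because the commutators of
    jm with any equivariant family are known explicitly. *)
Section Shift.
Variables (x : 'I_n -> B) (w : 'S_n -> B) (z u : 'I_n -> B).
Hypothesis bs : smash_sys x w.
Let w1 := smash_w1 bs.
Let wM := smash_ww bs.
Hypothesis uE : forall i, u i = z i + jm w i.
Local Notation t i j := (w (tperm i j)).
Local Notation jm := (jm w).

Lemma sum_neq_split (f : 'I_n -> B) i : \sum_(k | k != i) f k =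
  \sum_(k : 'I_n | (k < i)%N) f k + \sum_(k : 'I_n | (i < k)%N) f k.
Proof.
rewrite (bigID (fun k : 'I_n => (k < i)%N)) /=; congr (_ + _).
  by apply: eq_bigl => k; rewrite -val_eqE neq_ltn; case: ltngtP.
by apply: eq_bigl => k; rewrite -val_eqE neq_ltn; case: ltngtP.
Qed.

Lemma ux_zx i : commutator (u i) (x i) =
    kap * x i + \sum_(k : 'I_n | (k < i)%N) x k * t k i
              + \sum_(k : 'I_n | (i < k)%N) x i * t i k <->
  commutator (z i) (x i) = kap * x i + \sum_(k | k != i) x i * t i k.
Proof.
have S3E : x i * jm i = \sum_(k : 'I_n | (k < i)%N) x i * t i k.
  by rewrite mulr_sumr; apply: eq_bigr => k _; rewrite tpermC.
rewrite uE commutatorDl sum_neq_split -S3E [commutator (jm i) _]/commutator.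
rewrite (jm_v (equivariant_x bs)).
set S1 := \sum_(k < n | _) x k * _; set S2 := \sum_(k < n | _) x i * t i k.
set S3 := x i * _.
have -> : kap * x i + S1 + S2 = kap * x i + (S3 + S2) + (S1 - S3).
  by rewrite -!addrA; congr (_ + _); rewrite [RHS]addrC -!addrA addNr addr0 addrC.
by split=> [/addIr|->].
Qed.

Lemma ux_zx_gt (i j : 'I_n) : (j < i)%N ->
  commutator (u i) (x j) = - (x j * t j i) <->
  commutator (z i) (x j) = - (x i * t i j).
Proof.
move=> ji; rewrite uE commutatorDl (jm_v_lt (equivariant_x bs)) // mulrBl.
rewrite addrA (tpermC i); split=> [/(canRL (subrK _))|->].
  by rewrite addNr => /(canRL (addrK _)); rewrite sub0r.
by rewrite addNr sub0r.
Qed.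

Lemma ux_zx_lt (i j : 'I_n) : (i < j)%N ->
  commutator (u i) (x j) = - (x i * t i j) <->
  commutator (z i) (x j) = - (x i * t i j).
Proof. by move=> ij; rewrite uE commutatorDl (jm_v_gt (equivariant_x bs)) // addr0. Qed.

Lemma uu_zz (i j : 'I_n) : equivariant w z -> (i < j)%N ->
  commutator (u i) (u j) = 0 <-> commutator (z i) (z j) = (z j - z i) * t i j.
Proof.
move=> eqz ij; rewrite !uE commutatorDl !commutatorDr (jm_v_gt eqz) // add0r.
rewrite (commutator_eq0 (jm_comm wM _ _)) addr0.
rewrite (commutatorN (jm j)) (jm_v_lt eqz) //.
by split=> [/(canRL (subrK _))|->]; rewrite ?add0r ?subrr.
Qed.

Lemma su_zs (i i' : 'I_n) : i' = i.+1 :> nat ->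
  t i i' * u i = u i' * t i i' - 1 <-> t i i' * z i = z i' * t i i'.
Proof.
move=> ii'; rewrite !uE mulrDr mulrDl (jm_su w1 wM ii') addrA.
by split=> [/addIr/addIr|->].
Qed.

Lemma su'_zs (i i' : 'I_n) : i' = i.+1 :> nat ->
  t i i' * u i' = u i * t i i' + 1 <-> t i i' * z i' = z i * t i i'.
Proof.
move=> ii'; rewrite !uE mulrDr mulrDl (jm_su' w1 wM ii') addrA.
by split=> [/addIr/addIr|->].
Qed.

Lemma su''_zs (i i' j : 'I_n) : i' = i.+1 :> nat -> j != i -> j != i' ->
  t i i' * u j = u j * t i i' <-> t i i' * z j = z j * t i i'.
Proof.
move=> ii' ji ji'; rewrite !uE mulrDr mulrDl (jm_su'' wM ii') //.
by split=> [/addIr|->].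
Qed.

Lemma trig_z : trig_sys x w u <-> z_sys x w z.
Proof.
split=> [[_ uu su su' su'' ux uxgt uxlt]|[_ wz zx zx' zz]].
  have eqz : equivariant w z.
    apply: (equivariant_adj bs) => i i' j ii'.
    case: tpermP => [->|->|/eqP ji /eqP ji'].
    - exact/su_zs/su.
    - exact/su'_zs/su'.
    exact/su''_zs/su''.
  split=> // [i|i j|i j]; first exact/ux_zx/ux.
    rewrite -val_eqE neq_ltn => /orP[ij|ji]; first exact/ux_zx_lt/uxlt.
    exact/ux_zx_gt/uxgt.
  have H (a b : 'I_n) : (a < b)%N -> commutator (z a) (z b) = (z b - z a) * t a b.
    by move=> ab; apply/(uu_zz eqz ab)/commutator_eq0.
  rewrite -val_eqE neq_ltn => /orP[/H //|ji].
  by rewrite commutatorN H // -mulNr opprB tpermC.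
have ne (i j : 'I_n) : (i < j)%N -> (i != j) * (j != i).
  by move=> ij; rewrite -!val_eqE /= !neq_ltn ij orbT.
split=> // [i j|i i' ii'|i i' ii'|i i' j ii' ji ji'|i|i j ji|i j ij].
- have H (a b : 'I_n) : (a < b)%N -> u a * u b = u b * u a.
    move=> ab; apply/eqP; rewrite -subr_eq0; apply/eqP.
    by apply/(uu_zz _ ab) => //; apply: zz; rewrite (ne _ _ ab).
  by have [/H|/H|/val_inj ->] := ltngtP i j.
- by apply/(su_zs ii'); rewrite wz tpermL.
- by apply/(su'_zs ii'); rewrite wz tpermR.
- by apply/(su''_zs ii' ji ji'); rewrite wz tpermD // eq_sym.
- exact/ux_zx.
- by apply/ux_zx_gt => //; apply: zx'; rewrite (ne _ _ ji).
by apply/ux_zx_lt => //; apply: zx'; rewrite (ne _ _ ij).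
Qed.

End Shift.
End Systems.

Section RationalSystem.
Variables (B : pzRingType) (n : nat) (kap : B).
Hypothesis kapC : forall b, kap * b = b * kap.
Variables (x : 'I_n -> B) (w : 'S_n -> B).
Implicit Types (y : 'I_n -> B).
Local Notation t i j := (w (tperm i j)).

(** This identity rests on the cross relations alone, so that it can be read both
    ways: the relations between the z's are equivalent to the commutation of
    the y's, up to the factor x_i x_j. *)
Lemma xyxy y (bs : smash_sys x w) (eqy : equivariant w y)
    (yx' : forall i j, i != j -> commutator (y i) (x j) = - t i j) i j :
  i != j -> x i * y i * (x j * y j) = x i * x j * (y i * y j) - x i * y i * t i j.
Proof.
move=> ij; rewrite -!mulrA -mulrBr; congr (_ * _).
rewrite !mulrA (commutator_eq (yx' _ _ ij)) mulrDl mulNr -mulrA; congr (_ - _).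
by rewrite eqy tpermR.
Qed.

Lemma rat_equivariant y : rat_sys kap x w y -> equivariant w y.
Proof. by case=> bs _ sy _ _; apply: (equivariant_adj bs). Qed.

Lemma rat_to_z y : rat_sys kap x w y -> z_sys kap x w (fun i => x i * y i).
Proof.
move=> rs; have eqy := rat_equivariant rs; case: rs => bs yy sy yx yx'.
have eqx := equivariant_x bs; have xx := smash_xx bs.
have comm i j : commutator (x i * y i) (x j) = x i * commutator (y i) (x j).
  by rewrite /commutator mulrBr !mulrA (xx j).
split=> // [s j|i|i j ij|i j ij].
- by rewrite mulrA eqx -!mulrA eqy.
- by rewrite comm yx mulrDr mulr_sumr kapC.
- by rewrite comm yx' // mulrN.
have ji : j != i by rewrite eq_sym.
rewrite {1}/commutator !(xyxy bs eqy yx') // (xx j) (yy j) (tpermC j).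
by rewrite opprB addrC addrA subrK mulrBl.
Qed.

Section Inverses.
Variable xV : 'I_n -> B.
Hypotheses (xxV : forall i, x i * xV i = 1) (xVx : forall i, xV i * x i = 1).

Lemma mul_xI i a b : x i * a = x i * b -> a = b.
Proof. by move=> E; rewrite -[a]mul1r -(xVx i) -mulrA E mulrA xVx mul1r. Qed.

Lemma z_to_rat z : z_sys kap x w z -> rat_sys kap x w (fun i => xV i * z i).
Proof.
case=> bs wz zx zx' zz.
have eqx := equivariant_x bs; have xx := smash_xx bs.
have eqV : equivariant w xV.
  by move=> s j; apply: (@mul_xI (s j)); rewrite !mulrA -eqx xxV mul1r -mulrA xxV mulr1.
have eqy : equivariant w (fun i => xV i * z i).
  by move=> s j; rewrite mulrA eqV -!mulrA wz.
have comm i j : x i * commutator (xV i * z i) (x j) = commutator (z i) (x j).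
  by rewrite /commutator mulrBr !mulrA (xx i) -(mulrA (x j)) xxV mulr1 mul1r.
have yx' i j : i != j -> commutator (xV i * z i) (x j) = - t i j.
  by move=> ij; apply: (@mul_xI i); rewrite comm zx' // mulrN.
have E i : x i * (xV i * z i) = z i by rewrite mulrA xxV mul1r.
split=> // [i j|i].
  have [->//|ij] := eqVneq i j; have ji : j != i by rewrite eq_sym.
  apply: (@mul_xI j); apply: (@mul_xI i).
  rewrite [LHS]mulrA [RHS]mulrA.
  have := xyxy bs eqy yx' ij; rewrite !E => /esym/(canRL (subrK _)) ->.
  rewrite (xx i); have := xyxy bs eqy yx' ji; rewrite !E => /esym/(canRL (subrK _)) ->.
  have /commutator_eq -> := zz _ _ ij.
  by rewrite mulrBl -!addrA addNr addr0 tpermC.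
apply: (@mul_xI i); rewrite comm zx mulrDr mulr_sumr kapC //.
Qed.
End Inverses.

Definition xprod (l : seq 'I_n) := \prod_(j <- l) x j.

Section Products.
Hypothesis bs : smash_sys x w.
Let eqx := equivariant_x bs.
Let xx := smash_xx bs.

Lemma xprod_x l i : xprod l * x i = x i * xprod l.
Proof.
rewrite /xprod; elim: l => [|j l IH]; first by rewrite big_nil mul1r mulr1.
by rewrite big_cons -mulrA IH !mulrA (xx i).
Qed.

Lemma xprod_rem l i : i \in l -> xprod l = x i * xprod (rem i l).
Proof.
rewrite /xprod; elim: l => //= j l IH; rewrite inE.
have [-> _|ij] := eqVneq j i; first by rewrite big_cons.
by move=> /= /IH E; rewrite !big_cons E !mulrA (xx j).
Qed.

Lemma xprod_perm l l' : perm_eq l l' -> xprod l = xprod l'.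
Proof.
elim: l l' => [|i l IH] l' pl; first by move: pl; rewrite perm_sym => /perm_nilP ->.
have il' : i \in l' by rewrite -(perm_mem pl) mem_head.
rewrite (xprod_rem il') {1}/xprod big_cons; congr (_ * _); apply: IH.
by rewrite -(perm_cons i) (permPl pl) perm_to_rem.
Qed.

Lemma w_xprod (s : 'S_n) l : w s * xprod l = xprod (map s l) * w s.
Proof.
rewrite /xprod; elim: l => [|j l IH]; first by rewrite !big_nil mul1r mulr1.
by rewrite /= !big_cons mulrA eqx -!mulrA IH.
Qed.

Lemma t_xprod i j l : i \notin l -> j \notin l -> t i j * xprod l = xprod l * t i j.
Proof.
move=> il jl; rewrite w_xprod; congr (xprod _ * _).
apply: map_id_in => k kl; rewrite tpermD //.
  by apply: contraNneq il => ->.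
by apply: contraNneq jl => ->.
Qed.

(** The product p of all the x's, and the product of all but one. *)
Definition xfull := xprod (enum 'I_n).
Definition xbut i := xprod (rem i (enum 'I_n)).

Lemma xfullE i : xfull = x i * xbut i. Proof. by apply: xprod_rem; rewrite mem_enum. Qed.
Lemma xfullE' i : xfull = xbut i * x i. Proof. by rewrite xprod_x -xfullE. Qed.

Lemma w_xfull s : w s * xfull = xfull * w s.
Proof.
rewrite w_xprod; congr (_ * _); apply: xprod_perm.
apply: uniq_perm; rewrite ?(map_inj_uniq perm_inj) ?enum_uniq // => i.
rewrite mem_enum inE; apply/mapP; exists (s^-1%g i); first by rewrite mem_enum.
by rewrite permKV.
Qed.

Variable z : 'I_n -> B.
Hypothesis zs : z_sys kap x w z.

(** Leibniz rule, each commutator of z_i with a factor x_j leaving a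
    transposition s_ij that commutes with the remaining factors. *)
Lemma z_xprod i l : uniq l -> i \notin l ->
  z i * xprod l = xprod l * z i - \sum_(j <- l) x i * xprod (rem j l) * t i j.
Proof.
elim: l => [|a l IH] /=; first by rewrite /xprod !big_nil mulr1 mul1r subr0.
case/andP=> al ul; rewrite inE negb_or => /andP[ia il].
rewrite big_cons eqxx [xprod (a :: l)]big_cons -/(xprod l) mulrA.
rewrite (commutator_eq (zS_zx' zs ia)) mulrDl mulNr -!mulrA t_xprod //.
rewrite IH // mulrBr -!addrA; congr (_ + _).
rewrite addrC opprD; congr (_ + _); congr (- _).
rewrite mulr_sumr [LHS]big_seq [RHS]big_seq; apply: eq_bigr => j jl.
have /negPf -> : a != j by apply: contraNneq al => ->.
by rewrite [xprod (a :: _)]big_cons !mulrA (xx a).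
Qed.

(** In z_i p = z_i x_i q, the terms produced by [z_i, x_i] and by
    [z_i, q] cancel in pairs, except for kappa p. *)
Lemma z_xfull i : z i * xfull = xfull * (z i + kap).
Proof.
have ul : uniq (rem i (enum 'I_n)) by rewrite rem_uniq ?enum_uniq.
have memE j : (j \in rem i (enum 'I_n)) = (j != i).
  by rewrite mem_rem_uniq ?enum_uniq // inE mem_enum andbT.
have il : i \notin rem i (enum 'I_n) by rewrite memE eqxx.
rewrite (xfullE i) mulrA (commutator_eq (zS_zx zs i)) mulrDl -mulrA z_xprod //.
rewrite mulrDl mulrDr -/(xbut i) -(mulrA kap) kapC [x i * xbut i * (_ + _)]mulrDr.
rewrite mulrN (mulrA (x i)) -!addrA; congr (_ + _).
rewrite addrCA -[RHS]addr0; congr (_ + _); apply/eqP; rewrite addrC subr_eq0; apply/eqP.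
rewrite rem_filter ?enum_uniq // big_filter big_enum_cond /= -rem_filter ?enum_uniq //.
rewrite mulr_suml mulr_sumr; apply: eq_bigr => k ki.
rewrite -!mulrA; congr (_ * _).
have uk : uniq (rem k (rem i (enum 'I_n))) by rewrite rem_uniq.
rewrite /xbut {1}(@xprod_rem _ k) ?memE // mulrA eqx tpermR -!mulrA; congr (_ * _).
by apply: t_xprod; [apply: contra il; apply: mem_rem | rewrite mem_rem_uniqF].
Qed.

End Products.
End RationalSystem.

Section Degree.
Variables (B : pzRingType) (n : nat) (kap : B).
Variables (x : 'I_n -> B) (w : 'S_n -> B).
Hypothesis bs : smash_sys x w.
Local Notation t i j := (w (tperm i j)).

(** The transpositions in the commutators of the y_i with x_j cancel in the sum:
    y_1 + ... + y_n acts on the x's as the derivation kappa (d_1 + ... + d_n). *)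
Lemma commutator_Yx y j : rat_sys kap x w y -> commutator (\sum_i y i) (x j) = kap.
Proof.
move=> rs; rewrite commutator_suml (bigD1 j) //= (ratS_yx rs) -addrA -big_split /=.
rewrite big1 ?addr0 // => k kj.
by rewrite (ratS_yx' rs) // (tpermC j) subrr.
Qed.

(** The sum of the u's is an Euler element: it measures the degree in x. *)
Lemma commutator_ux u j : trig_sys kap x w u ->
  commutator (\sum_i u i) (x j) = kap * x j.
Proof.
move=> ts; rewrite commutator_suml (bigD1 j) //= (trigS_ux ts) sum_neq_split.
rewrite (eq_bigr _ (fun k kj => trigS_ux_lt ts kj)).
rewrite (eq_bigr _ (fun k kj => trigS_ux_gt ts kj)).
by rewrite !sumrN -!addrA [X in _ + (_ + X)]addrCA !addrA !addrK.
Qed.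

(** The sum of the Jucys-Murphy elements is the sum of all transpositions, which
    is central in the group algebra. *)
Lemma sum_jm_w s : w s * (\sum_i jm w i) = (\sum_i jm w i) * w s.
Proof.
have w1 := smash_w1 bs; have wM := smash_ww bs; move: s.
apply: perm_adj_ind => [|a b Ha Hb|i i' ii'].
- by rewrite w1 mul1r mulr1.
- by rewrite -wM -mulrA Ha !mulrA Hb.
have ne : i' != i by rewrite -val_eqE /= ii' neq_ltn ltnSn orbT.
rewrite (bigD1 i) //= (bigD1 i') //= addrA mulrDr mulrDl; congr (_ + _).
  rewrite mulrDr mulrDl (jm_su w1 wM ii') (jm_su' w1 wM ii').
  by rewrite addrACA addNr addr0 addrC.
rewrite mulr_sumr mulr_suml; apply: eq_bigr => j /andP[ji ji'].
exact: jm_su''.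
Qed.

End Degree.

(** * Conjugation by p, and saturation *)
Section Shifts.
Variables (B : pzRingType) (n : nat) (kap : B).
Hypothesis kapC : forall b, kap * b = b * kap.
Variables (x : 'I_n -> B) (w : 'S_n -> B) (u : 'I_n -> B).
Hypothesis ts : trig_sys kap x w u.
Let bs := trig_base ts.

Lemma trig_shift c : (forall b, c * b = b * c) -> trig_sys kap x w (fun i => u i - c).
Proof.
move=> cC.
have cw i a : commutator (u i - c) a = commutator (u i) a.
  rewrite commutatorDl [X in _ + X](_ : _ = 0) ?addr0 //.
  by rewrite /commutator mulNr mulrN opprK cC addNr.
split=> // [i j|i i' ii'|i i' ii'|i i' j ii' ji ji'|i|i j ij|i j ij].
- rewrite -[RHS]addr0; apply: commutator_eq.
  by rewrite cw commutatorN cw commutator_eq0 ?oppr0 // (trigS_uu ts).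
- by rewrite mulrBr mulrBl cC (trigS_su ts ii') addrAC.
- by rewrite mulrBr mulrBl cC (trigS_su' ts ii') addrAC.
- by rewrite mulrBr mulrBl cC (trigS_su'' ts ii').
- by rewrite cw (trigS_ux ts).
- by rewrite cw (trigS_ux_gt ts).
by rewrite cw (trigS_ux_lt ts).
Qed.

(** Conjugation by p fixes x and w and shifts u by kappa: the powers of p satisfy
    the Ore condition. *)
Lemma xfull_u i : xfull x * u i = (u i - kap) * xfull x.
Proof.
have uE j : u j = (u j - jm w j) + jm w j by rewrite subrK.
have zs : z_sys kap x w (fun j => u j - jm w j) by apply/(trig_z _ bs uE).
have jp : jm w i * xfull x = xfull x * jm w i.
  by rewrite mulr_suml mulr_sumr; apply: eq_bigr => k _; rewrite (w_xfull bs).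
rewrite mulrBl {2}(uE i) mulrDl (z_xfull kapC bs zs) jp -mulrDr addrAC subrK.
by rewrite kapC mulrDr addrK.
Qed.

Lemma xfullX_u k i : xfull x ^+ k * u i = (u i - kap *+ k) * xfull x ^+ k.
Proof.
elim: k => [|k IH]; first by rewrite mul1r mulr1 subr0.
rewrite exprSr -mulrA xfull_u mulrA mulrBr IH -kapC -mulrBl mulrSr opprD addrA.
by rewrite mulrA.
Qed.

End Shifts.

Lemma commutator_pow (B : pzRingType) (a b c : B) k :
  (forall d, c * d = d * c) -> commutator a b = c ->
  a * b ^+ k.+1 = b ^+ k.+1 * a + (c *+ k.+1) * b ^+ k.
Proof.
move=> cC abc; elim: k => [|k IH]; first by rewrite !mulr1 (commutator_eq abc).
rewrite exprS mulrA (commutator_eq abc) mulrDl -mulrA IH mulrDr !mulrA -exprS.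
rewrite -addrA [c *+ k.+2]mulrSr mulrDl; congr (_ + (_ + _)).
by rewrite !mulrnAr !mulrnAl -cC -mulrA -exprS.
Qed.

(** Differentiation argument.  N is a subgroup of an R-module V stable under the
    action of A through phi, and v is killed by a power of y.  In
    y x^(k+1) v = x^(k+1) (y v) + (k+1) kappa x^k v the vector y v belongs to N,
    by induction on the exponent of y that kills v; hence x^(k+1) v in N
    implies x^k v in N, and so on down to v in N. *)
Section Saturation.
Variables (A R : pzRingType) (phi : {rmorphism A -> R}) (n : nat).
Variables (x : 'I_n -> A) (y kap : A).
Hypothesis kapC : forall b, kap * b = b * kap.
Hypothesis kapV : forall k, exists c, c * (kap *+ k.+1) = 1.
Hypothesis yx : forall i, commutator y (x i) = kap.
Variables (V : lmodType R) (N : V -> Prop).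
Hypothesis NB : forall u v, N u -> N v -> N (u - v).
Hypothesis NZ : forall a v, N v -> N (phi a *: v).

Lemma saturating_x i K k (v : V) : phi y ^+ K *: v = 0 -> N (phi (x i ^+ k) *: v) -> N v.
Proof.
have cp l : y * x i ^+ l.+1 = x i ^+ l.+1 * y + (kap *+ l.+1) * x i ^+ l.
  exact: commutator_pow.
elim: K v k => [|K IH] v k.
  rewrite scale1r => ->; rewrite scaler0; exact: id.
move=> yv Nv; have Nyv : N (phi y *: v).
  apply: (IH _ k.+1); first by rewrite scalerA -exprSr.
  rewrite scalerA -rmorphM.
  have -> : x i ^+ k.+1 * y = y * (x i * x i ^+ k) - (kap *+ k.+1) * x i ^+ k.
    by rewrite -exprS cp addrK.
  rewrite rmorphB scalerBl !rmorphM -!scalerA.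
  by apply: (NB); [apply: (NZ); apply: (NZ) | apply: (NZ)].
elim: k Nv => [|k IHk]; first by rewrite rmorph1 scale1r.
move=> Nv; apply: IHk; have [c cK] := kapV k.
rewrite -[phi _ *: v]scale1r -(rmorph1 phi) -cK rmorphM -scalerA; apply: NZ.
rewrite scalerA -rmorphM.
have -> : (kap *+ k.+1) * x i ^+ k = y * x i ^+ k.+1 - x i ^+ k.+1 * y.
  by rewrite cp addrC addKr.
by rewrite rmorphB scalerBl !rmorphM -!scalerA; apply: (NB); apply: (NZ).
Qed.

Lemma nil_x i K (v : V) : phi y ^+ K *: v = 0 -> phi y ^+ K.+1 *: (phi (x i) *: v) = 0.
Proof.
move=> yv; rewrite scalerA.
have H : commutator (x i) y = - kap by rewrite commutatorN yx.
have NkC d : - kap * d = d * - kap by rewrite mulNr mulrN kapC.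
have := commutator_pow K NkC H => /(canLR (addrK _)) E.
rewrite -rmorphXn -rmorphM -E rmorphB scalerBl !rmorphM !rmorphXn -!scalerA.
rewrite yv scaler0 subr0.
by rewrite exprS -scalerA yv !scaler0.
Qed.

Lemma nil_xprod K l (v : V) : phi y ^+ K *: v = 0 ->
  exists K', phi y ^+ K' *: (phi (xprod x l) *: v) = 0.
Proof.
move=> yv; rewrite /xprod; elim: l => [|i l [K' E]].
  by exists K; rewrite big_nil rmorph1 scale1r.
by exists K'.+1; rewrite big_cons rmorphM -scalerA nil_x.
Qed.

Lemma saturating_xprod K l v :
  phi y ^+ K *: v = 0 -> N (phi (xprod x l) *: v) -> N v.
Proof.
move=> yv; elim: l => [|i l IH]; first by rewrite /xprod big_nil rmorph1 scale1r.
rewrite /xprod big_cons rmorphM -scalerA => Nv; apply: IH.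
have [K' E] := nil_xprod l yv; apply: (saturating_x (i := i) (k := 1) E).
by rewrite expr1.
Qed.

Lemma saturating_xfull K k (v : V) :
  phi y ^+ K *: v = 0 -> N (phi (xfull x) ^+ k *: v) -> N v.
Proof.
elim: k K v => [|k IH] K v yv; first by rewrite scale1r.
have [K' E] := nil_xprod (enum 'I_n) yv.
by rewrite exprSr -scalerA => /(IH _ _ E)/(saturating_xprod yv).
Qed.

End Saturation.

Lemma xprod_inv (B : pzRingType) (n : nat) (x xV : 'I_n -> B) l :
  (forall i, x i * xV i = 1) -> (forall i, xV i * x i = 1) ->
  exists b, b * xprod x l = 1 /\ xprod x l * b = 1.
Proof.
move=> xxV xVx; rewrite /xprod; elim: l => [|i l [b [bl lb]]].
  by exists 1; rewrite big_nil mulr1.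
exists (b * xV i); rewrite big_cons; split.
  by rewrite mulrA -(mulrA b) xVx mulr1.
by rewrite mulrA -(mulrA (x i)) lb mulr1.
Qed.

(** The set of b such that for each k some p^k' b belongs to iota(A) p^k is closed
    under sums and products, so that it suffices to consider the generators
    of B. *)
Section OreCondition.
Variables (A B : pzRingType) (n : nat) (iota : {rmorphism A -> B}).
Variables (C : Type) (cA : C -> A) (cB : C -> B).
Variables (ka : A) (x : 'I_n -> A) (w : 'S_n -> A) (u : 'I_n -> A).
Variables (kb : B) (X XV U : 'I_n -> B) (W : 'S_n -> B).
Hypotheses (kbC : forall b, kb * b = b * kb) (cBC : forall c b, cB c * b = b * cB c).
Hypotheses (XXV : forall i, X i * XV i = 1) (XVX : forall i, XV i * X i = 1).
Hypothesis ts : trig_sys kb X W U.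
Hypotheses (ioX : forall i, iota (x i) = X i) (ioW : forall s, iota (w s) = W s)
  (ioU : forall i, iota (u i) = U i) (ioC : forall c, iota (cA c) = cB c)
  (iok : iota ka = kb).
Hypothesis indB : forall P : B -> Prop, (forall c, P (cB c)) ->
  (forall i, P (X i)) -> (forall i, P (XV i)) -> (forall s, P (W s)) ->
  (forall i, P (U i)) -> (forall a b, P a -> P b -> P (a + b)) ->
  (forall a b, P a -> P b -> P (a * b)) -> forall a, P a.

Lemma map_xprod l : iota (xprod x l) = xprod X l.
Proof. by rewrite rmorph_prod; apply: eq_bigr => i _; rewrite ioX. Qed.

Lemma ore_of_generators b k :
  exists k' a, iota (xfull x) ^+ k' * b = iota a * iota (xfull x) ^+ k.
Proof.
have tb := trig_base ts.
have comm b' : xfull X * b' = b' * xfull X ->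
    forall k, xfull X ^+ k * b' = b' * xfull X ^+ k.
  by move=> E m; symmetry; apply: commrX; apply: esym.
rewrite [iota (xfull x)]map_xprod -/(xfull X).
move: k; elim/indB: b => [c|i|i|s|i|a b Ha Hb|a b Ha Hb] k.
- by exists k, (cA c); rewrite ioC cBC.
- exists k, (x i); rewrite ioX comm //; exact: (xprod_x tb).
- exists k.+1, (xbut x i); rewrite [iota _]map_xprod exprSr -mulrA.
  rewrite {2}(xfullE' tb i) -mulrA XXV mulr1 comm //.
  by rewrite {1}(xfullE' tb i) -mulrA -(xfullE tb i).
- by exists k, (w s); rewrite ioW comm // (w_xfull tb).
- by exists k, (u i - ka *+ k); rewrite rmorphB rmorphMn ioU iok (xfullX_u kbC ts).
- have [k1 [a1 E1]] := Ha k; have [k2 [a2 E2]] := Hb k.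
  exists (k1 + k2)%N, (xfull x ^+ k2 * a1 + xfull x ^+ k1 * a2).
  rewrite mulrDr {1}addnC !exprD -!mulrA E1 E2 rmorphD !rmorphM !rmorphXn.
  by rewrite [iota (xfull x)]map_xprod !mulrA -mulrDl.
have [k1 [a1 E1]] := Hb k; have [k2 [a2 E2]] := Ha k1.
by exists k2, (a2 * a1); rewrite mulrA E2 -mulrA E1 mulrA rmorphM.
Qed.
End OreCondition.

(** * Universal property of presented algebras *)

(** B * F is nontrivial even if B = 0; evaluating in it and projecting to B covers
    the case of a trivial target. *)
Section NonzeroHull.
Variables (B : pzRingType) (F : fieldType).
Definition nonzero_hull : Type := (B * F)%type.
HB.instance Definition _ := GRing.PzRing.on nonzero_hull.
Fact nonzero_hull_neq0 : (1 : nonzero_hull) != 0.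
Proof. by apply/eqP => /(congr1 snd) /eqP; rewrite oner_eq0. Qed.
HB.instance Definition _ :=
  GRing.PzSemiRing_isNonZero.Build nonzero_hull nonzero_hull_neq0.
End NonzeroHull.

Section FreeUniversal.
Variables (F : fieldType) (G : choiceType) (B : pzRingType).
Variable (cst : {rmorphism F -> B}) (g : G -> B).
Hypothesis cstC : forall c a, cst c * g a = g a * cst c.

Let B' := nonzero_hull B F.
Let cst' (c : F) : B' := (cst c, c).
Let word' (m : {fmonom G}) : B' := (\prod_(a <- m) g a, 1).

Fact cst'_zmod : zmod_morphism cst'.
Proof. by move=> a b; rewrite /cst' rmorphB. Qed.
Fact cst'_monoid : monoid_morphism cst'.
Proof. by split=> [|a b]; rewrite /cst' ?rmorph1 ?rmorphM. Qed.
Fact word'_monoid : mmorphism word'.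
Proof.
split=> [m m'|]; rewrite /word'.
  by rewrite fmM big_cat /=; congr (_, _); rewrite mul1r.
by rewrite fm1 big_nil.
Qed.

Lemma free_univ : exists f : {rmorphism free_alg F G -> B},
  (forall a, f (free_gen F a) = g a) /\ (forall c a, f (c *: a) = cst c * f a).
Proof.
pose c' : {rmorphism F -> B'} := HB.pack cst'
  (GRing.isZmodMorphism.Build _ _ cst' cst'_zmod)
  (GRing.isMonoidMorphism.Build _ _ cst' cst'_monoid).
pose w' : {mmorphism {fmonom G} -> B'} := HB.pack word'
  (isMultiplicative.Build _ _ word' word'_monoid).
have commr (a : free_alg F G) m m' : GRing.comm (c' a@_m) (w' m').
  congr (_, _); last exact: mulrC.
  by apply: commr_prod => a' _; apply: cstC.
pose ev a := (mmap c' w' a).1.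
have evB : zmod_morphism ev by move=> a b; rewrite /ev raddfB.
have evM : monoid_morphism ev.
  have [M1 M2] := commr_mmap_is_multiplicative commr.
  by split=> [|a b]; rewrite /ev ?M1 ?M2.
pose f : {rmorphism free_alg F G -> B} := HB.pack ev
  (GRing.isZmodMorphism.Build _ _ ev evB)
  (GRing.isMonoidMorphism.Build _ _ ev evM).
exists f; split=> [a|c a].
  by rewrite /= /ev mmapU /= big_seq1 rmorph1 mul1r.
by rewrite /= /ev mmapZ.
Qed.
End FreeUniversal.

Lemma free_alg_ind (F : fieldType) (G : choiceType) (P : free_alg F G -> Prop) :
  (forall c, P (c *: 1)) -> (forall a, P (free_gen F a)) ->
  (forall a b, P a -> P b -> P (a + b)) -> (forall a b, P a -> P b -> P (a * b)) ->
  forall a, P a.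
Proof.
move=> Pc Pg PD PM a; rewrite [a]monalgE.
have P1 : P 1 by rewrite -[1]scale1r.
elim/big_ind: _ => // [|k _]; first by rewrite -(scale0r 1).
suff Pk : P << k >>.
  have -> : << a@_k *g k >> = (a@_k *: 1) * << k >>.
    by rewrite -scalerAl mul1r; apply/malgP => m; rewrite mcoeffZ !mcoeffU mulrnAr mulr1.
  exact: PM.
case: k => s; elim: s => [|x s IH].
  by rewrite -fmoneE.
have -> : << FMonom (x :: s) >> = free_gen F x * << FMonom s >>.
  by rewrite /free_gen [RHS]fgmulUU mulr1; congr mkmalgU; apply/eqP; rewrite fmP fmM.
exact: PM.
Qed.

Section PresUniversal.
Variables (F : fieldType) (G : choiceType).
Variable R : free_alg F G -> free_alg F G -> Prop.

Lemma pres_alg_ind (P : pres_alg R -> Prop) :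
  (forall c, P (c *: (1 : pres_alg R))) -> (forall a, P (pres_gen R a)) ->
  (forall a b, P a -> P b -> P (a + b)) -> (forall a b, P a -> P b -> P (a * b)) ->
  forall a, P a.
Proof.
move=> Pc Pg PD PM u; have [x ->] := pres_proj_surj u; elim/free_alg_ind: x => //.
- move=> c; rewrite linearZ rmorph1. exact: Pc.
- by move=> a b Pa Pb; rewrite rmorphD; apply: PD.
by move=> a b Pa Pb; rewrite rmorphM; apply: PM.
Qed.

Lemma pres_alg_central (c : F) (u : pres_alg R) :
  (c *: (1 : pres_alg R)) * u = u * (c *: (1 : pres_alg R)).
Proof. by rewrite -pres_scalerAl -pres_scalerAr mul1r mulr1. Qed.

Lemma pres_factor (B : pzRingType) (f : {rmorphism free_alg F G -> B}) :
  (forall p q, R p q -> f p = f q) ->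
  exists f' : {rmorphism pres_alg R -> B}, forall x, f' (pres_proj R x) = f x.
Proof.
move=> fR; pose f' (u : pres_alg R) : B := f (generic_quotient.repr u).
have f'E x : f' (pres_proj R x) = f x.
  have : in_ideal R (generic_quotient.repr (pres_proj R x) - x).
    by apply/pres_projP; rewrite {1}/pres_proj /quot_proj reprK.
  rewrite /f' => H; apply/eqP; rewrite -subr_eq0 -rmorphB; apply/eqP.
  elim: H => [|a b p q y /fR E _ IH]; first by rewrite rmorph0.
  by rewrite rmorphD IH addr0 !rmorphM rmorphB E subrr mulr0 mul0r.
have f'B : zmod_morphism f'.
  move=> u v; have [x ->] := pres_proj_surj u; have [y ->] := pres_proj_surj v.
  by rewrite -rmorphB !f'E rmorphB.
have f'M : monoid_morphism f'.
  split=> [|u v]; first by rewrite -(rmorph1 (pres_proj R)) f'E rmorph1.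
  have [x ->] := pres_proj_surj u; have [y ->] := pres_proj_surj v.
  by rewrite -rmorphM !f'E rmorphM.
pose f'' : {rmorphism pres_alg R -> B} := HB.pack f'
  (GRing.isZmodMorphism.Build _ _ f' f'B)
  (GRing.isMonoidMorphism.Build _ _ f' f'M).
by exists f''.
Qed.

End PresUniversal.

(** The ring of additive endomorphisms of V: an A-module structure on V is a ring
    morphism from A to it. *)
Section Endomorphisms.
Variable V : zmodType.

Record endo := Endo { endo_fun :> V -> V; endoB : zmod_morphism endo_fun }.
HB.instance Definition _ := gen_eqMixin endo.
HB.instance Definition _ := gen_choiceMixin endo.

Lemma endoP (f g : endo) : (forall v, f v = g v) -> f = g.
Proof.
case: f g => f fB [g gB] /= /funext E; rewrite E in fB *.
by congr Endo; apply: Prop_irrelevance.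
Qed.

HB.instance Definition _ (f : endo) :=
  GRing.isZmodMorphism.Build V V (endo_fun f) (endoB f).

Fact endo0_subproof : zmod_morphism (fun _ : V => 0 : V).
Proof. by move=> a b; rewrite subr0. Qed.
Fact endo1_subproof : zmod_morphism (fun v : V => v).
Proof. by []. Qed.
Fact endoN_subproof (f : endo) : zmod_morphism (fun v => - f v).
Proof. by move=> a b; rewrite raddfB opprB opprK addrC. Qed.
Fact endoD_subproof (f g : endo) : zmod_morphism (fun v => f v + g v).
Proof. by move=> a b; rewrite !raddfB opprD addrACA. Qed.
Fact endoM_subproof (f g : endo) : zmod_morphism (fun v => f (g v)).
Proof. by move=> a b; rewrite !raddfB. Qed.

Fact endo_addA : associative (fun f g => Endo (endoD_subproof f g)).
Proof. by move=> f g h; apply: endoP => v; apply: addrA. Qed.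
Fact endo_addC : commutative (fun f g => Endo (endoD_subproof f g)).
Proof. by move=> f g; apply: endoP => v; apply: addrC. Qed.
Fact endo_add0 : left_id (Endo endo0_subproof) (fun f g => Endo (endoD_subproof f g)).
Proof. by move=> f; apply: endoP => v; apply: add0r. Qed.
Fact endo_addN : left_inverse (Endo endo0_subproof) (fun f => Endo (endoN_subproof f))
  (fun f g => Endo (endoD_subproof f g)).
Proof. by move=> f; apply: endoP => v; apply: addNr. Qed.

HB.instance Definition _ :=
  GRing.isZmodule.Build endo endo_addA endo_addC endo_add0 endo_addN.

Fact endo_mulA : associative (fun f g => Endo (endoM_subproof f g)).
Proof. by move=> f g h; apply: endoP. Qed.
Fact endo_mul1 : left_id (Endo endo1_subproof) (fun f g => Endo (endoM_subproof f g)).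
Proof. by move=> f; apply: endoP. Qed.
Fact endo_1mul : right_id (Endo endo1_subproof) (fun f g => Endo (endoM_subproof f g)).
Proof. by move=> f; apply: endoP. Qed.
Fact endo_mulDl : left_distributive (fun f g => Endo (endoM_subproof f g)) +%R.
Proof. by move=> f g h; apply: endoP. Qed.
Fact endo_mulDr : right_distributive (fun f g => Endo (endoM_subproof f g)) +%R.
Proof. by move=> f g h; apply: endoP => v; apply: raddfD. Qed.

HB.instance Definition _ := GRing.Zmodule_isPzRing.Build endo
  endo_mulA endo_mul1 endo_1mul endo_mulDl endo_mulDr.

End Endomorphisms.

(** * Localization of nilpotent modules *)
Section Submodules.
Variables (R : pzRingType) (M : lmodType R).

Section Make.
Variable P : M -> Prop.
Hypotheses (P0 : P 0) (PD : forall u v, P u -> P v -> P (u + v))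
  (PZ : forall a v, P v -> P (a *: v)).
Definition submod_of : {pred M} := fun v => `[< P v >].
Fact submod_of_closed : subsemimod_closed submod_of.
Proof.
split=> [|a v /asboolP Pv]; first split; first exact/asboolP.
  by move=> u v /asboolP Pu /asboolP Pv; apply/asboolP/PD.
exact/asboolP/PZ.
Qed.
Lemma ex_submod : exists N : submodClosed M, forall v, (v \in N) <-> P v.
Proof.
pose N : submodClosed M := HB.pack submod_of
  (GRing.isSubSemiModClosed.Build R M submod_of submod_of_closed).
by exists N => v; split=> /asboolP.
Qed.
End Make.

Lemma submod0 (N : submodClosed M) : 0 \in N.
Proof. exact: rpred0. Qed.
Lemma submodD (N : submodClosed M) u v : u \in N -> v \in N -> u + v \in N.
Proof. exact: rpredD. Qed.
Lemma submodZ (N : submodClosed M) a v : v \in N -> a *: v \in N.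
Proof. exact: rpredZ. Qed.
Lemma submodB (N : submodClosed M) u v : u \in N -> v \in N -> u - v \in N.
Proof. by move=> Nu Nv; rewrite -scaleN1r; apply/submodD/submodZ. Qed.

Lemma ex_linear (L : lmodType R) (f : M -> L) :
  (forall u v, f (u - v) = f u - f v) -> (forall a u, f (a *: u) = a *: f u) ->
  exists g : {linear M -> L}, forall u, g u = f u.
Proof.
move=> fB fZ; pose g : {linear M -> L} := HB.pack f
  (GRing.isZmodMorphism.Build _ _ f fB) (GRing.isScalable.Build _ _ _ _ f fZ).
by exists g.
Qed.

Lemma iso_intro (L : lmodType R) (f : {linear M -> L}) :
  (forall u, f u = 0 -> u = 0) -> (forall v, exists u, f u = v) -> iso_mod M L.
Proof.
move=> f0 fs; have [h hE] := choice fs; exists f; exists h => // u.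
by apply/eqP; rewrite -subr_eq0; apply/eqP/f0; rewrite linearB hE subrr.
Qed.

End Submodules.

Lemma ex_additive (U V : zmodType) (f : U -> V) :
  (forall u v, f (u - v) = f u - f v) ->
  exists g : {additive U -> V}, forall u, g u = f u.
Proof.
move=> fB; pose g : {additive U -> V} := HB.pack f
  (GRing.isZmodMorphism.Build _ _ f fB).
by exists g.
Qed.

(** B is a localization of A at the powers of p: iota p is invertible and every
    element of B is a left fraction.  The element y of A is the one whose local
    nilpotency is required of A-modules. *)
Section OreLocalization.
Variables (A B : pzRingType) (iota : {rmorphism A -> B}) (p y : A) (pV : B).
Hypotheses (pVp : pV * iota p = 1) (ppV : iota p * pV = 1).
Hypothesis ore : forall b k, exists k' a,
  iota p ^+ k' * b = iota a * iota p ^+ k.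

Definition nilmod (M : lmodType A) := forall m : M, exists K, y ^+ K *: m = 0.

(** The conclusion of the differentiation argument, for the A-action obtained
    through phi.  It is used for phi the identity, on M, and for phi = iota, on
    the localization. *)
Definition saturating (R : pzRingType) (phi : {rmorphism A -> R}) :=
  forall (V : lmodType R) (N : V -> Prop),
  (forall u v, N u -> N v -> N (u - v)) ->
  (forall a v, N v -> N (phi a *: v)) ->
  forall v K k, phi y ^+ K *: v = 0 -> N (phi p ^+ k *: v) -> N v.

Hypotheses (satA : saturating (@idfun A : {rmorphism A -> A})) (satB : saturating iota).

(** V is M[1/p] and j the localization map.  This form makes the pairs stable
    under subquotients without any construction of M[1/p]. *)
Record ore_pair (M : lmodType A) (V : lmodType B) (j : {additive M -> V}) : Prop :=
  OrePair {
    ore_equiv : forall a m, j (a *: m) = iota a *: j m;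
    ore_inj : forall m, j m = 0 -> m = 0;
    ore_dense : forall v, exists k m, iota p ^+ k *: v = j m }.

Lemma pVpX k : pV ^+ k * iota p ^+ k = 1.
Proof.
elim: k => [|k IH]; first by rewrite mulr1.
by rewrite exprSr exprS mulrA -(mulrA _ pV) pVp mulr1.
Qed.
Lemma ppVX k : iota p ^+ k * pV ^+ k = 1.
Proof.
elim: k => [|k IH]; first by rewrite mulr1.
by rewrite exprSr exprS mulrA -(mulrA _ (iota p)) ppV mulr1.
Qed.

Lemma pX_inj (V : lmodType B) k (u v : V) :
  iota p ^+ k *: u = iota p ^+ k *: v -> u = v.
Proof. by move=> E; rewrite -[u]scale1r -(pVpX k) -scalerA E scalerA pVpX scale1r. Qed.

Lemma pX_submod (V : lmodType B) (N : submodClosed V) k v :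
  iota p ^+ k *: v \in N -> v \in N.
Proof. by move/(submodZ (pV ^+ k)); rewrite scalerA pVpX scale1r. Qed.

Lemma saturated_submod (M : lmodType A) (N : submodClosed M) k m :
  nilmod M -> p ^+ k *: m \in N -> m \in N.
Proof.
move=> nilM Nm; have [K Km] := nilM m.
apply: (satA (N := fun v => v \in N)) Km Nm; first exact: submodB.
by move=> a v; apply: submodZ.
Qed.

Section Pair.
Variables (M : lmodType A) (V : lmodType B) (j : {additive M -> V}).
Hypotheses (jP : ore_pair j) (nilM : nilmod M).

Lemma ore_equivX k m : j (p ^+ k *: m) = iota p ^+ k *: j m.
Proof. by rewrite (ore_equiv jP) rmorphXn. Qed.

Lemma j_inj m m' : j m = j m' -> m = m'.
Proof.
move=> E; apply/eqP; rewrite -subr_eq0; apply/eqP/(ore_inj jP).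
by rewrite raddfB E subrr.
Qed.

(** N is the preimage of N', that is, N' = N[1/p]. *)
Definition corresp (N : submodClosed M) (N' : submodClosed V) :=
  forall m, (j m \in N') = (m \in N).

Lemma ex_restrict (N' : submodClosed V) : exists N, corresp N N'.
Proof.
have [|u v|a v|N NE] := @ex_submod _ M (fun m => j m \in N').
- by rewrite raddf0 submod0.
- by rewrite raddfD; apply: submodD.
- by rewrite (ore_equiv jP); apply: submodZ.
by exists N => m; apply/idP/idP => /NE.
Qed.

(** Nothing is lost when N is replaced by N[1/p]: a vector of M in N[1/p] has a
    multiple p^k m in N, hence is in N by saturation. *)
Lemma ex_extend (N : submodClosed M) : exists N', corresp N N'.
Proof.
pose P v := exists k m, m \in N /\ iota p ^+ k *: v = j m.
have [|u v|b v|N' N'E] := @ex_submod _ V P.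
- by exists 0%N, 0; rewrite submod0 scaler0 raddf0.
- case=> k [m [Nm mE]] [l [m' [Nm' mE']]].
  exists (k + l)%N, (p ^+ l *: m + p ^+ k *: m').
  split; first by apply: submodD; apply: submodZ.
  by rewrite (raddfD j) !ore_equivX -mE -mE' !scalerA -!exprD (addnC l) scalerDr.
- case=> k [m [Nm mE]]; have [k' [a E]] := ore b k.
  exists k', (a *: m); split; first exact: submodZ.
  by rewrite scalerA E -scalerA mE (ore_equiv jP).
exists N' => m; apply/idP/idP => [/N'E [k [m' [Nm']]]|Nm].
  by rewrite -ore_equivX => /j_inj E; apply: (@saturated_submod _ _ k) nilM _; rewrite E.
by apply/N'E; exists 0%N, m; rewrite scale1r.
Qed.

Lemma ore_simple : simple_mod M <-> simple_mod V.
Proof.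
split=> [[[m m0] sM]|[[v v0] sV]].
  split=> [|N'].
    by exists (j m); apply: contra_neq m0 => /(ore_inj jP).
  have [N NN'] := ex_restrict N'; have [N0|N1] := sM N; [left|right] => v.
    move=> N'v; have [k [m' mE]] := ore_dense jP v; apply: (@pX_inj _ k).
    by rewrite mE scaler0 (N0 m') ?raddf0 // -NN' -mE submodZ.
  have [k [m' mE]] := ore_dense jP v; apply: (@pX_submod _ _ k).
  by rewrite mE NN'.
split=> [|N].
  have [k [m mE]] := ore_dense jP v; exists m; apply: contra_neq v0 => m0.
  by apply: (@pX_inj _ k); rewrite mE m0 raddf0 scaler0.
have [N' NN'] := ex_extend N; have [N0|N1] := sV N'; [left|right] => m.
  by rewrite -NN' => /N0/(ore_inj jP).
by rewrite -NN'.
Qed.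

End Pair.

Lemma in_trace (R : pzRingType) (M : lmodType R) (N P : submodClosed M)
  (u : sub_mod P) : (u \in @trace_mod _ _ N P) = (val u \in N).
Proof. by []. Qed.

(** Pairs pass to subquotients, by corresponding submodules. *)
Section Subquotient.
Variables (M : lmodType A) (V : lmodType B) (j : {additive M -> V}).
Hypotheses (jP : ore_pair j) (nilM : nilmod M).
Variables (N P : submodClosed M) (N' P' : submodClosed V).
Hypotheses (NN' : corresp j N N') (PP' : corresp j P P').

Lemma nil_subquot : nilmod (subquot_mod N P).
Proof.
move=> t; have [u ->] := quot_proj_surj t; have [K Km] := nilM (val u).
exists K; rewrite -linearZ /=.
have -> : y ^+ K *: u = 0 by apply: val_inj.
exact: raddf0.
Qed.

Lemma ore_subquot :
  exists j' : {additive subquot_mod N P -> subquot_mod N' P'}, ore_pair j'.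
Proof.
have jsub (u : sub_mod P) : j (val u) \in P' by rewrite PP' (valP u).
pose js (u : sub_mod P) : sub_mod P' := exist _ (j (val u)) (jsub u).
pose jq (t : subquot_mod N P) : subquot_mod N' P' :=
  quot_proj (@trace_mod _ _ N' P') (js (generic_quotient.repr t)).
have jqE u : jq (quot_proj (@trace_mod _ _ N P) u) =
    quot_proj (@trace_mod _ _ N' P') (js u).
  apply/quot_projP.
  have : generic_quotient.repr (quot_proj (@trace_mod _ _ N P) u) - u
      \in @trace_mod _ _ N P.
    by apply/quot_projP; rewrite {1}/quot_proj reprK.
  rewrite !in_trace /= => H.
  set r := generic_quotient.repr _ in H *.
  by move: H; rewrite -NN' (raddfB j).
have jqB u v : jq (u - v) = jq u - jq v.
  have [u' ->] := quot_proj_surj u; have [v' ->] := quot_proj_surj v.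
  rewrite -raddfB !jqE -raddfB; congr quot_proj; apply: val_inj => /=.
  exact: raddfB.
have [j' j'E] := ex_additive jqB; exists j'; split=> [a t|t|t].
- have [u ->] := quot_proj_surj t; rewrite -linearZ !j'E !jqE -linearZ.
  by congr quot_proj; apply: val_inj; rewrite /= (ore_equiv jP).
- have [u ->] := quot_proj_surj t; rewrite j'E jqE -(raddf0 (quot_proj _)) => /quot_projP.
  rewrite subr0 in_trace NN' => Nu.
  by rewrite -(raddf0 (quot_proj _)); apply/quot_projP; rewrite subr0.
have [v ->] := quot_proj_surj t; have [k [m mE]] := ore_dense jP (val v).
have Pm : m \in P by rewrite -PP' -mE; apply: submodZ; apply: (valP v).
exists k, (quot_proj (@trace_mod _ _ N P) (exist _ m Pm)); rewrite j'E jqE -linearZ.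
by congr quot_proj; apply: val_inj.
Qed.
End Subquotient.

(** Localization is functorial; conversely M is recovered from V as the set of
    vectors killed by a power of y, which any isomorphism preserves. *)
Section Isomorphisms.
Variables (M M' : lmodType A) (V V' : lmodType B).
Variables (j : {additive M -> V}) (j' : {additive M' -> V'}).
Hypotheses (jP : ore_pair j) (nilM : nilmod M).
Hypotheses (jP' : ore_pair j') (nilM' : nilmod M').

Lemma ore_iso_loc : iso_mod M M' -> iso_mod V V'.
Proof.
case=> g [h hK gK].
have [kf kfP] := choice (ore_dense jP); have [mf mfP] := choice kfP.
pose f v := pV ^+ kf v *: j' (g (mf v)).
have gX k m : j' (g (p ^+ k *: m)) = iota p ^+ k *: j' (g m).
  by rewrite linearZ (ore_equivX jP').
(* f v does not depend on the fraction that represents v *)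
have fE k m v : iota p ^+ k *: v = j m -> iota p ^+ k *: f v = j' (g m).
  move=> E; apply: (@pX_inj _ (kf v)).
  rewrite scalerA -exprD addnC exprD -scalerA [iota p ^+ kf v *: f v]scalerA ppVX scale1r.
  rewrite -!gX; congr (j' (g _)); apply: (j_inj jP).
  by rewrite !(ore_equivX jP) -E -mfP !scalerA -!exprD addnC.
have [|b v|F FE] := @ex_linear _ V V' f.
- move=> v w; have [k [m mE]] := ore_dense jP v.
  have [l [m' mE']] := ore_dense jP w; apply: (@pX_inj _ (k + l)).
  rewrite (fE _ (p ^+ l *: m - p ^+ k *: m')).
    rewrite scalerBr {2}exprD addnC exprD -!scalerA (fE _ _ _ mE) (fE _ _ _ mE').
    by rewrite (raddfB g) (raddfB j') !gX.
  by rewrite scalerBr {2}exprD addnC exprD -!scalerA mE mE' (raddfB j) !(ore_equivX jP).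
- have [k [m mE]] := ore_dense jP v; have [k' [a E]] := ore b k.
  apply: (@pX_inj _ k'); rewrite (fE _ (a *: m)).
    by rewrite scalerA E -scalerA (fE _ _ _ mE) linearZ (ore_equiv jP').
  by rewrite scalerA E -scalerA mE (ore_equiv jP).
apply: (iso_intro (f := F)) => [v|v']; rewrite ?FE.
  have [k [m mE]] := ore_dense jP v => f0; have := fE _ _ _ mE.
  rewrite f0 scaler0 => /esym/(ore_inj jP') gm0; apply: (@pX_inj _ k).
  by rewrite mE scaler0 -[m]hK gm0 -[0 in LHS](raddf0 g) hK raddf0.
have [k [m' mE]] := ore_dense jP' v'; exists (pV ^+ k *: j (h m')).
rewrite FE; apply: (@pX_inj _ k); rewrite (fE _ (h m')) ?gK //.
by rewrite scalerA ppVX scale1r.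
Qed.

Lemma nil_in_image (W : lmodType A) (U : lmodType B) (i : {additive W -> U}) K v :
  ore_pair i -> iota y ^+ K *: v = 0 -> exists m, i m = v.
Proof.
move=> iP yv; have [k [m mE]] := ore_dense iP v.
apply: (satB (N := fun v => exists m, i m = v)) yv _.
- by move=> _ _ [a <-] [b <-]; exists (a - b); rewrite raddfB.
- by move=> a _ [b <-]; exists (a *: b); rewrite (ore_equiv iP).
by exists m; rewrite -mE.
Qed.

Lemma ore_iso_res : iso_mod V V' -> iso_mod M M'.
Proof.
case=> f [h hK fK].
have jyE (W : lmodType A) (U : lmodType B) (i : {additive W -> U}) m K :
    ore_pair i -> y ^+ K *: m = 0 -> iota y ^+ K *: i m = 0.
  by move=> iP E; rewrite -rmorphXn -(ore_equiv iP) E raddf0.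
have [m|g gE] := @choice _ _ (fun m m' => j' m' = f (j m)).
  have [K Km] := nilM m; apply: (nil_in_image (K := K)) => //.
  by rewrite -linearZ /= (jyE _ _ _ _ _ jP Km) raddf0.
have [u v|a v|F FE] := @ex_linear _ M M' g.
- by apply: (j_inj jP'); rewrite (raddfB j') !gE (raddfB j) raddfB.
- by apply: (j_inj jP'); rewrite (ore_equiv jP') !gE (ore_equiv jP) linearZ.
apply: (iso_intro (f := F)) => [m|m'].
  rewrite FE => gm0; apply: (ore_inj jP); rewrite -[j m]hK -gE gm0 raddf0.
  by rewrite -[0 in LHS](raddf0 f) hK.
have [K Km] := nilM' m'; have E := jyE _ _ _ _ _ jP' Km.
have [|m mE] := nil_in_image (K := K) (v := h (j' m')) jP.
  by rewrite -[LHS]hK linearZ /= fK E -[0 in LHS](raddf0 f) hK.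
by exists m; rewrite FE; apply: (j_inj jP'); rewrite gE mE fK.
Qed.

Lemma ore_iso : iso_mod M M' <-> iso_mod V V'.
Proof. by split; [apply: ore_iso_loc | apply: ore_iso_res]. Qed.

End Isomorphisms.

(** Corresponding chains of submodules are composition series at the same time
    and have the same number of factors of a given isomorphism type. *)
Theorem ore_multiplicity (M L : lmodType A) (V L' : lmodType B)
    (j : {additive M -> V}) (jL : {additive L -> L'}) :
  ore_pair j -> nilmod M -> ore_pair jL -> nilmod L ->
  multiplicity M L = multiplicity V L'.
Proof.
move=> jP nilM jLP nilL.
have sq N P N' P' : corresp j N N' -> corresp j P P' ->
    (simple_mod (subquot_mod N P) <-> simple_mod (subquot_mod N' P')) /\
    (iso_mod (subquot_mod N P) L <-> iso_mod (subquot_mod N' P') L').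
  move=> NN' PP'; have [j' jP'] := ore_subquot jP NN' PP'.
  have nilNP : nilmod (subquot_mod N P) by apply: nil_subquot.
  by split; [exact: (ore_simple jP' nilNP) | exact: (ore_iso jP' nilNP jLP nilL)].
have corrP N N' P P' : corresp j N N' -> corresp j P P' ->
    {subset N <= P} <-> {subset N' <= P'}.
  move=> NN' PP'; split=> sNP v.
    move=> N'v; have [k [m mE]] := ore_dense jP v; apply: (@pX_submod _ _ k).
    by rewrite mE PP'; apply: sNP; rewrite -NN' -mE; apply: submodZ.
  by rewrite -NN' => /sNP; rewrite PP'.
have main l (S : nat -> submodClosed M) (S' : nat -> submodClosed V) :
    (forall i, corresp j (S i) (S' i)) ->
    (composition_series l S <-> composition_series l S') /\
    count_factors L l S = count_factors L' l S'.
  move=> SS'; split; last first.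
    apply: eq_bigr => i _; congr nat_of_bool; apply: asbool_equiv_eq.
    by case: (sq _ _ _ _ (SS' i) (SS' i.+1)).
  split=> -[S0 Sl Si]; split.
  - move=> v; apply/idP/eqP => [S'v|->]; last exact: submod0.
    have [k [m mE]] := ore_dense jP v; apply: (@pX_inj _ k); rewrite mE scaler0.
    have /eqP -> : m == 0 by rewrite -S0 -SS' -mE; apply: submodZ.
    exact: raddf0.
  - move=> v; have [k [m mE]] := ore_dense jP v; apply: (@pX_submod _ _ k).
    by rewrite mE SS'.
  - move=> i /Si [sS sim]; split; first exact/(corrP _ _ _ _ (SS' i) (SS' i.+1)).
    by case: (sq _ _ _ _ (SS' i) (SS' i.+1)) => -[H _] _; apply: H.
  - move=> m; apply/idP/eqP => [|->]; last exact: submod0.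
    by rewrite -SS' S0 => /eqP/(ore_inj jP).
  - by move=> m; rewrite -SS'.
  move=> i /Si [sS sim]; split; first exact/(corrP _ _ _ _ (SS' i) (SS' i.+1)).
  by case: (sq _ _ _ _ (SS' i) (SS' i.+1)) => -[_ H] _; apply: H.
rewrite /multiplicity; congr xget; apply/seteqP; split=> m /= [l [S [cS ->]]].
  have [S' SS'] := choice (fun i => ex_extend jP nilM (S i)).
  by have [[H _] ->] := main l S S' SS'; exists l, S'; split=> //; apply: H.
have [S' SS'] := choice (fun i => ex_restrict jP (S i)).
by have [[_ H] <-] := main l S' S SS'; exists l, S'; split=> //; apply: H.
Qed.

End OreLocalization.

(** If a sum of two proper submodules of M is always proper, M has at most one
    maximal submodule; its localization is the only maximal submodule of V.  In
    the proof, K1 is the kernel of M -> L and K2 the preimage in M of the kernel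
    of V -> L'. *)
Section SimpleQuotients.
Variables (A B : pzRingType) (iota : {rmorphism A -> B}) (p y : A) (pV : B).
Hypotheses (pVp : pV * iota p = 1).
Hypothesis ore : forall b k, exists k' a,
  iota p ^+ k' * b = iota a * iota p ^+ k.
Hypotheses (satA : saturating p y (@idfun A : {rmorphism A -> A})).
Variables (M : lmodType A) (V : lmodType B) (j : {additive M -> V}).
Hypotheses (jP : ore_pair iota p j) (nilM : nilmod y M).
Hypothesis sumP : forall K1 K2 : submodClosed M,
  ~ (forall m, m \in K1) -> ~ (forall m, m \in K2) ->
  ~ (forall m, exists a b, [/\ a \in K1, b \in K2 & m = a + b]).

Lemma ore_simple_quotient (L : lmodType A) (L' : lmodType B) :
  simple_quotient M L -> simple_quotient V L' ->
  (exists jL : {additive L -> L'}, ore_pair iota p jL) /\ nilmod y L.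
Proof.
move=> [[[l l0] simL] [f fs]] [[[l' l'0] simL'] [g gs]]; split; last first.
  move=> z; have [m <-] := fs z; have [K Km] := nilM m.
  by exists K; rewrite -linearZ Km raddf0.
have [||a v|K1 K1E] := @ex_submod _ M (fun m => f m = 0).
- exact: raddf0.
- by move=> u v u0 v0; rewrite linearD u0 v0 addr0.
- by move=> v0; rewrite linearZ /= v0 scaler0.
have [||a v|K2 K2E] := @ex_submod _ M (fun m => g (j m) = 0).
- by rewrite !raddf0.
- by move=> u v u0 v0; rewrite (raddfD j) linearD u0 v0 addr0.
- by move=> v0; rewrite (ore_equiv jP) linearZ /= v0 scaler0.
have pK1 : ~ (forall m, m \in K1).
  move=> all; move: l0; have [m <-] := fs l.
  by have /K1E -> := all m; rewrite eqxx.
have pK2 : ~ (forall m, m \in K2).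
  move=> all; move: l'0; have [v <-] := gs l'.
  have [k [m mE]] := ore_dense jP v; case/eqP.
  apply: (pX_inj pVp (k := k)); rewrite scaler0 -linearZ /= mE.
  exact/K2E/all.
have nsum := sumP pK1 pK2.
(* otherwise f maps K2 onto L, so that K1 + K2 = M *)
have K21 m : m \in K2 -> f m = 0.
  have [||a t|T TE] := @ex_submod _ L (fun t => exists2 m, m \in K2 & f m = t).
  - by exists 0; rewrite ?submod0 ?raddf0.
  - by move=> s t [m1 K1m <-] [m2 K2m <-]; exists (m1 + m2); rewrite ?linearD ?submodD.
  - by case=> m1 K1m <-; exists (a *: m1); rewrite ?linearZ ?submodZ.
  have [T0|T1] := simL T; first by move=> K2m; apply/T0/TE; exists m.
  case: nsum => m'; have /TE[b K2b fb] := T1 (f m').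
  exists (m' - b), b; split=> //; last by rewrite subrK.
  by apply/K1E; rewrite linearB fb subrr.
(* otherwise K1[1/p] is mapped onto L', so that K1 + K2 contains a multiple
   p^k m of each m, hence m itself by saturation *)
have K12 m : m \in K1 -> g (j m) = 0.
  pose PT t := exists k m, m \in K1 /\ iota p ^+ k *: t = g (j m).
  have [||b t|T TE] := @ex_submod _ L' PT.
  - by exists 0%N, 0; rewrite submod0 scaler0 !raddf0.
  - move=> s t [k [m1 [K1m E1]]] [k' [m2 [K2m E2]]].
    exists (k + k')%N, (p ^+ k' *: m1 + p ^+ k *: m2).
    split; first by apply: submodD; apply: submodZ.
    rewrite (raddfD j) linearD !(ore_equivX jP) !linearZ /= -E1 -E2.
    by rewrite !scalerA -!exprD (addnC k') scalerDr.
  - case=> k [m1 [K1m E1]]; have [k' [a E]] := ore b k.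
    exists k', (a *: m1); split; first exact: submodZ.
    by rewrite scalerA E -scalerA E1 (ore_equiv jP) linearZ.
  have [T0|T1] := simL' T.
    by move=> K1m; apply/T0/TE; exists 0%N, m; rewrite scale1r.
  case: nsum => m'.
  have [||a v|S SE] := @ex_submod _ M
    (fun m => exists a b, [/\ a \in K1, b \in K2 & m = a + b]).
  - by exists 0, 0; rewrite !submod0 addr0.
  - move=> _ _ [a [b [Ka Kb ->]]] [a' [b' [Ka' Kb' ->]]].
    by exists (a + a'), (b + b'); rewrite !submodD // addrACA.
  - case=> a' [b' [Ka' Kb' ->]]; exists (a *: a'), (a *: b').
    by rewrite !submodZ // scalerDr.
  apply/SE; have /TE[k [m1 [K1m E1]]] := T1 (g (j m')).
  apply: (saturated_submod satA (k := k)) => //; apply/SE; exists m1, (p ^+ k *: m' - m1).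
  split=> //; last by rewrite addrC subrK.
  by apply/K2E; rewrite (raddfB j) linearB (ore_equivX jP) linearZ /= E1 subrr.
have [r rE] := choice fs.
have jf m : g (j (r (f m))) = g (j m).
  apply/eqP; rewrite -subr_eq0 -linearB -raddfB; apply/eqP/K12/K1E.
  by rewrite linearB rE subrr.
have [s t|jL jLE] := @ex_additive L L' (fun t => g (j (r t))).
  have [m <-] := fs s; have [m' <-] := fs t.
  by rewrite -linearB !jf (raddfB j) linearB.
exists jL; split=> [a t|t|t'].
- have [m <-] := fs t; rewrite -linearZ !jLE !jf (ore_equiv jP) linearZ //.
- have [m <-] := fs t; rewrite jLE jf => gm; apply: K21; exact/K2E.
have [v <-] := gs t'; have [k [m mE]] := ore_dense jP v.
by exists k, (f m); rewrite jLE jf -linearZ /= mE.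
Qed.
End SimpleQuotients.

(** * Grading by the degree in x *)

(** M is generated by a subspace V0 that is stable under w and killed by the y's,
    and on which the sum of the transpositions acts as the scalar c0. *)
Section Grading.
Variables (F : fieldType) (A : pzRingType) (n : nat) (cA : {rmorphism F -> A}).
Variables (kappa : F) (x y : 'I_n -> A) (w : 'S_n -> A).
Hypothesis cAC : forall c a, cA c * a = a * cA c.
Hypothesis rs : rat_sys (cA kappa) x w y.
Local Notation u i := (x i * y i + jm w i).
Hypothesis indA : forall P : A -> Prop, (forall c, P (cA c)) ->
  (forall i, P (x i)) -> (forall s, P (w s)) -> (forall i, P (y i)) ->
  (forall a b, P a -> P b -> P (a + b)) ->
  (forall a b, P a -> P b -> P (a * b)) -> forall a, P a.
Variables (M : lmodType A) (V0 : M -> Prop) (c0 : F).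
Hypotheses (V00 : V0 0) (V0D : forall a b, V0 a -> V0 b -> V0 (a + b)).
Hypothesis V0c : forall c v, V0 v -> V0 (cA c *: v).
Hypothesis V0w : forall s v, V0 v -> V0 (w s *: v).
Hypothesis V0y : forall i v, V0 v -> y i *: v = 0.
Hypothesis V0jm : forall v, V0 v -> (\sum_i jm w i) *: v = cA c0 *: v.
Hypothesis gen : forall P : M -> Prop, P 0 -> (forall a b, P a -> P b -> P (a + b)) ->
  (forall h v, V0 v -> P (h *: v)) -> forall m, P m.

(** Products of k variables x applied to V0.  The sum of these subspaces is direct,
    since the Euler element separates them. *)
Inductive deg : nat -> M -> Prop :=
| deg_V0 v of V0 v : deg 0 v
| deg_0 k : deg k 0
| deg_D k a b of deg k a & deg k b : deg k (a + b)
| deg_X k i v of deg k v : deg k.+1 (x i *: v).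

Lemma deg0 v : deg 0 v -> V0 v.
Proof.
suff H k v' : deg k v' -> k = 0%N -> V0 v' by move/H; apply.
by elim=> // k' a b _ Ha _ Hb k0; apply: V0D; [apply: Ha | apply: Hb].
Qed.

Lemma deg_c c k v : deg k v -> deg k (cA c *: v).
Proof.
elim=> [v' V|k'|k' a b _ Ha _ Hb|k' i v' _ IH].
- by apply/deg_V0/V0c.
- by rewrite scaler0; apply: deg_0.
- by rewrite scalerDr; apply: deg_D.
by rewrite scalerA cAC -scalerA; apply: deg_X.
Qed.

Lemma deg_N k v : deg k v -> deg k (- v).
Proof. by move/(deg_c (-1)); rewrite rmorphN1 scaleN1r. Qed.

Lemma deg_w s k v : deg k v -> deg k (w s *: v).
Proof.
elim=> [v' V|k'|k' a b _ Ha _ Hb|k' i v' _ IH].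
- by apply/deg_V0/V0w.
- by rewrite scaler0; apply: deg_0.
- by rewrite scalerDr; apply: deg_D.
by rewrite scalerA (equivariant_x (rat_base rs)) -scalerA; apply: deg_X.
Qed.

Lemma deg_sum (I : finType) (P : pred I) k (v : I -> M) :
  (forall i, P i -> deg k (v i)) -> deg k (\sum_(i | P i) v i).
Proof.
by move=> Hv; elim/big_ind: _ => //; [apply: deg_0 | move=> a b; apply: deg_D].
Qed.

Lemma deg_comm k i j v : deg k v -> deg k (commutator (y i) (x j) *: v).
Proof.
move=> Hv; have [<-|ij] := eqVneq i j; last first.
  by rewrite (ratS_yx' rs ij) scaleNr; apply/deg_N/deg_w.
rewrite (ratS_yx rs) scalerDl scaler_suml; apply: deg_D; first exact: deg_c.
by apply: deg_sum => l _; apply: deg_w.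
Qed.

Lemma deg_y i k v : deg k v -> if k is k'.+1 then deg k' (y i *: v) else y i *: v = 0.
Proof.
elim=> [v' V|k'|[|k'] a b _ Ha _ Hb|k' j v' Hv IH].
- exact: V0y.
- by case: k' => [|k']; rewrite scaler0 //; apply: deg_0.
- by rewrite scalerDr Ha Hb addr0.
- by rewrite scalerDr; apply: deg_D.
rewrite scalerA (commutator_eq (erefl (commutator (y i) (x j)))) scalerDl -scalerA.
apply: deg_D; last exact: deg_comm.
by case: k' Hv IH => [|k'] Hv IH; [rewrite IH scaler0; apply: deg_0 | apply: deg_X].
Qed.

Definition deg_lt D m :=
  exists s : nat -> M, (forall k, deg k (s k)) /\ m = \sum_(k < D) s k.

Lemma deg_lt_le D D' m : (D <= D')%N -> deg_lt D m -> deg_lt D' m.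
Proof.
move=> le_D [s [Hs ->]]; exists (fun k => if (k < D)%N then s k else 0); split=> [k|].
  by case: ifP => _ //; apply: deg_0.
by rewrite (big_ord_widen _ _ le_D) -big_mkcond.
Qed.

Lemma deg_lt_D D m m' : deg_lt D m -> deg_lt D m' -> deg_lt D (m + m').
Proof.
case=> s [Hs ->] [s' [Hs' ->]]; exists (fun k => s k + s' k); split=> [k|].
  exact: deg_D.
by rewrite big_split.
Qed.

Lemma deg_lt_max D D' m m' : deg_lt D m -> deg_lt D' m' ->
  deg_lt (maxn D D') m /\ deg_lt (maxn D D') m'.
Proof.
move=> fm fm'; split; [apply: deg_lt_le fm | apply: deg_lt_le fm'].
  exact: leq_maxl.
exact: leq_maxr.
Qed.

Lemma deg_lt_map D m a : deg_lt D m -> (forall k v, deg k v -> deg k (a *: v)) ->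
  deg_lt D (a *: m).
Proof.
case=> s [Hs ->] Ha; exists (fun k => a *: s k); split=> [k|]; first exact: Ha.
by rewrite scaler_sumr.
Qed.

Lemma ex_deg_lt m : exists D, deg_lt D m.
Proof.
elim/gen: m => [|a b [D HD] [D' HD']|h v V].
- by exists 0%N, (fun=> 0); split=> [k|]; [apply: deg_0 | rewrite big_ord0].
- by have [f1 f2] := deg_lt_max HD HD'; exists (maxn D D'); apply: deg_lt_D.
have : exists D, deg_lt D v.
  exists 1%N, (fun k => if k is 0 then v else 0).
  split=> [[|k]|]; last by rewrite big_ord1.
    exact: deg_V0.
  exact: deg_0.
move: v {V}; elim/indA: h => [c|i|s|i|a b Ha Hb|a b Ha Hb] v [D Hv].
- by exists D; apply: (deg_lt_map Hv) => k v'; apply: deg_c.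
- case: Hv => s [Hs ->]; exists D.+1, (fun k => if k is k'.+1 then x i *: s k' else 0).
  split=> [[|k]|]; first exact: deg_0; first exact: deg_X.
  by rewrite big_ord_recl add0r scaler_sumr.
- by exists D; apply: (deg_lt_map Hv) => k v'; apply: deg_w.
- case: Hv => s [Hs ->]; exists D.-1, (fun k => y i *: s k.+1); split=> [k|].
    exact: (deg_y i (Hs k.+1)).
  case: D => [|D]; first by rewrite !big_ord0 scaler0.
  by rewrite big_ord_recl scalerDr (deg_y i (Hs 0%N)) add0r scaler_sumr.
- have Hv' := ex_intro (fun D => deg_lt D v) D Hv.
  have [D1 H1] := Ha _ Hv'; have [D2 H2] := Hb _ Hv'.
  have [f1 f2] := deg_lt_max H1 H2; exists (maxn D1 D2).
  by rewrite scalerDl; apply: deg_lt_D.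
by rewrite -scalerA; apply/Ha/Hb; exists D.
Qed.

Lemma sum_y_deg k v : deg k v -> (\sum_i y i) ^+ k.+1 *: v = 0.
Proof.
elim: k v => [|k IH] v Hv.
  rewrite expr1 scaler_suml big1 // => i _; exact: (deg_y i Hv).
rewrite exprSr -scalerA; apply: IH; rewrite scaler_suml.
apply: deg_sum => i _; exact: (deg_y i Hv).
Qed.

Lemma sum_y_nil (m : M) : exists K, (\sum_i y i) ^+ K *: m = 0.
Proof.
have [D [s [Hs ->]]] := ex_deg_lt m; exists D; rewrite scaler_sumr big1 // => k _.
have := ltn_ord k; move: (nat_of_ord k) => l /subnK <-.
by rewrite exprD -scalerA (sum_y_deg (Hs l)) scaler0.
Qed.

Local Notation eu := (\sum_i u i).

Hypothesis kapC : forall b, cA kappa * b = b * cA kappa.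

(** [eu, x_i] = kappa x_i, and on V0 the terms x_i y_i vanish. *)
Lemma euler_deg k v : deg k v -> eu *: v = cA (kappa *+ k + c0) *: v.
Proof.
have ts : trig_sys (cA kappa) x w (fun i => u i).
  apply/(trig_z _ (rat_base rs) (fun i => erefl)); exact: rat_to_z rs.
elim=> [v' V|k'|k' a b _ Ha _ Hb|k' i v' _ IH].
- rewrite mulr0n add0r big_split scalerDl V0jm // scaler_suml big1 ?add0r // => i _.
  by rewrite -scalerA V0y // scaler0.
- by rewrite !scaler0.
- by rewrite !scalerDr Ha Hb.
rewrite scalerA (commutator_eq (commutator_ux i ts)) scalerDl -!scalerA IH.
rewrite mulrSr addrAC [in RHS]rmorphD scalerDl; congr (_ + _).
by rewrite !scalerA cAC.
Qed.

(** Lagrange interpolation in the Euler element: a nonzero multiple of the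
    projection to degree 0, on vectors of degree at most D. *)
Fixpoint euler_proj D : A :=
  if D is D'.+1 then (eu - cA (kappa *+ D + c0)) * euler_proj D' else 1.

Lemma euler_proj_deg D k v : deg k v ->
  euler_proj D *: v = cA (\prod_(l < D) (kappa *+ k - kappa *+ l.+1)) *: v.
Proof.
move=> Hv; elim: D => [|D IH]; first by rewrite big_ord0 rmorph1.
rewrite big_ord_recr /= -scalerA IH scalerA -cAC -scalerA scalerBl (euler_deg Hv).
by rewrite -scalerBl -rmorphB opprD addrACA subrr addr0 scalerA -rmorphM mulrC.
Qed.

Hypothesis kappa_nat : forall k, kappa *+ k.+1 != 0.

Lemma euler_proj_lowest D m : deg_lt D.+1 m -> V0 (euler_proj D *: m).
Proof.
case=> s [Hs ->]; rewrite big_ord_recl scalerDr scaler_sumr big1 ?addr0 => [|k _].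
  by rewrite (euler_proj_deg _ (Hs 0%N)); apply/V0c/deg0/Hs.
rewrite (euler_proj_deg _ (Hs _)) (bigD1 k) //= subrr mul0r rmorph0 scale0r //.
Qed.

Lemma euler_proj_inj D (v : M) : V0 v -> euler_proj D *: v = 0 -> v = 0.
Proof.
move=> V; rewrite (euler_proj_deg _ (deg_V0 V)) => /(congr1 (fun v =>
  cA (\prod_(l < D) (kappa *+ 0 - kappa *+ l.+1))^-1 *: v)).
rewrite scaler0 scalerA -rmorphM mulVf ?rmorph1 ?scale1r //.
by apply/prodf_neq0 => l _; rewrite mulr0n sub0r oppr_eq0.
Qed.

Hypothesis irr : forall (K : submodClosed M) v, V0 v -> v != 0 -> v \in K ->
  forall v', V0 v' -> v' \in K.

Lemma proper_V0 (K : submodClosed M) : ~ (forall m, m \in K) ->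
  forall v, V0 v -> v \in K -> v = 0.
Proof.
move=> properK v V Kv; apply: contra_notP properK => /eqP v0.
have VK := irr V v0 Kv; apply: gen => [|a b|h v' V']; first exact: submod0.
  exact: submodD.
by apply/submodZ/VK.
Qed.

(** If K1 + K2 = M, write a vector of V0 as a + b and project to degree 0: the
    projections of a and b are in V0 and in K1 and K2 respectively, hence
    vanish.  So V0 = 0 and M = 0. *)
Theorem sum_proper (K1 K2 : submodClosed M) :
  ~ (forall m, m \in K1) -> ~ (forall m, m \in K2) ->
  ~ (forall m, exists a b, [/\ a \in K1, b \in K2 & m = a + b]).
Proof.
move=> pK1 pK2 all_sum; apply: (pK1).
have V0_0 v : V0 v -> v = 0.
  move=> V; have [a [b [Ka Kb E]]] := all_sum v.
  have [D fa] := ex_deg_lt a; have [D' fb] := ex_deg_lt b.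
  have [{}fa {}fb] := deg_lt_max fa fb; set m := maxn D D' in fa fb.
  apply: (euler_proj_inj (D := m) V); rewrite E scalerDr.
  have Pa := euler_proj_lowest (deg_lt_le (leqnSn m) fa).
  have Pb := euler_proj_lowest (deg_lt_le (leqnSn m) fb).
  have Ea := proper_V0 pK1 Pa (submodZ _ Ka).
  have Eb := proper_V0 pK2 Pb (submodZ _ Kb).
  exact: etrans (congr2 +%R Ea Eb) (addr0 0).
apply: gen => [|a b|h v /V0_0 ->]; first exact: submod0; first exact: submodD.
by rewrite scaler0 submod0.
Qed.

End Grading.

(** * Induced modules *)
Section InducedModules.
Variables (F : fieldType) (n : nat) (G : choiceType).
Variable R : free_alg F G -> free_alg F G -> Prop.
Local Notation H := (pres_alg R).
Local Notation FS := 'M[F]_#|[set: 'S_n]|.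
Variables (d : nat) (rE : mx_representation F [set: 'S_n] d).
Variable gens : H -> FS -> Prop.
Hypothesis gens_ring : forall b a, gens b a -> (a \in group_ring F [set: 'S_n])%MS.
Local Notation f := (hom_graph gens).
Local Notation Ind := (induced_mod rE f).

Lemma hom_graph_ring b a : f b a -> (a \in group_ring F [set: 'S_n])%MS.
Proof.
elim=> [b' a' /gens_ring //|c|b1 b2 a1 a2 _ E1 _ E2|b1 b2 a1 a2 _ E1 _ E2].
- by rewrite -scalemx1 linearZ scalemx_sub // envelop_mx1.
- by rewrite linearD addmx_sub.
exact: envelop_mxM.
Qed.

Definition tensor1 (v : 'rV[F]_d) : Ind :=
  quot_proj (span_mod (tensor_rel rE f)) (tensor 1 v).

Lemma tensor1B u v : tensor1 (u - v) = tensor1 u - tensor1 v.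
Proof.
rewrite /tensor1 -raddfB; congr quot_proj.
by apply/rowP => j; rewrite !mxE scalerBl.
Qed.

Lemma tensor1Z c v : tensor1 (c *: v) = (c *: (1 : H)) *: tensor1 v.
Proof.
rewrite /tensor1 -linearZ; congr quot_proj.
apply/rowP => j; rewrite !mxE /=.
by rewrite -[RHS]pres_scalerAl mul1r scalerA.
Qed.

Lemma tensorE h v : tensor h v = h *: (tensor 1 v : 'rV[H]_d).
Proof.
by apply/rowP => j; rewrite !mxE /= -[RHS]pres_scalerAr mulr1.
Qed.

Lemma tensor1_act b a v : f b a -> b *: tensor1 v = tensor1 (v *m gring_op rE a).
Proof.
move=> fba; rewrite /tensor1 -linearZ -tensorE; apply/quot_projP.
apply/asboolP; rewrite -[X in in_span _ X]addr0 -[X in in_span _ (X + _)]scale1r.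
by constructor; [rewrite -[b]mul1r; constructor | constructor].
Qed.

Lemma row_tensor (r : 'rV[H]_d) : r = \sum_j tensor (r 0 j) (delta_mx 0 j : 'rV[F]_d).
Proof.
apply/rowP => j; rewrite summxE (bigD1 j) //= big1 => [|k kj].
  by rewrite !mxE !eqxx scale1r addr0.
by rewrite !mxE eqxx eq_sym (negPf kj) scale0r.
Qed.

Lemma induced_ind (P : Ind -> Prop) :
  P 0 -> (forall u v, P u -> P v -> P (u + v)) -> (forall h v, P (h *: tensor1 v)) ->
  forall u, P u.
Proof.
move=> P0 PD Pt u; have [r ->] := quot_proj_surj u.
have E j : quot_proj (span_mod (tensor_rel rE f)) (tensor (r 0 j) (delta_mx 0 j))
    = r 0 j *: tensor1 (delta_mx 0 j) by rewrite /tensor1 -linearZ -tensorE.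
rewrite [r]row_tensor raddf_sum (eq_bigr _ (fun j _ => E j)).
by elim/big_ind: _.
Qed.

Section Universal.
Variables (C : pzRingType) (phi : {rmorphism H -> C}) (Q : lmodType C).
Variable e : {additive 'rV[F]_d -> Q}.
Hypothesis eZ : forall c v, e (c *: v) = phi (c *: (1 : H)) *: e v.
Hypothesis egen : forall b a v, gens b a -> phi b *: e v = e (v *m gring_op rE a).

Lemma e_graph b a v : f b a -> phi b *: e v = e (v *m gring_op rE a).
Proof.
move=> fba.
elim: fba v => [b' a' g v|c v|b1 b2 a1 a2 _ E1 _ E2 v|b1 b2 a1 a2 f1 E1 _ E2 v].
- exact: egen.
- by rewrite -eZ -scalemx1 linearZ /= gring_op1 -scalemxAr mulmx1.
- by rewrite rmorphD scalerDl E1 E2 linearD mulmxDr raddfD.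
rewrite rmorphM -scalerA E2 E1 gring_opM ?mulmxA //.
exact: hom_graph_ring f1.
Qed.

(** Frobenius reciprocity.  Compatibility of e with the subalgebra from which one
    induces is required on its generators only, since [hom_graph] is generated
    by them. *)
Lemma induced_univ : exists Phi : {additive Ind -> Q},
  (forall h u, Phi (h *: u) = phi h *: Phi u) /\ (forall v, Phi (tensor1 v) = e v).
Proof.
pose Psi (r : 'rV[H]_d) : Q := \sum_j phi (r 0 j) *: e (delta_mx 0 j).
have PsiB r s : Psi (r - s) = Psi r - Psi s.
  by rewrite /Psi -sumrB; apply: eq_bigr => j _; rewrite !mxE rmorphB scalerBl.
have PsiD r s : Psi (r + s) = Psi r + Psi s.
  by rewrite /Psi -big_split; apply: eq_bigr => j _; rewrite !mxE rmorphD scalerDl.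
have PsiZ h r : Psi (h *: r) = phi h *: Psi r.
  by rewrite /Psi scaler_sumr; apply: eq_bigr => j _; rewrite !mxE rmorphM scalerA.
have Psi1 v : Psi (tensor 1 v) = e v.
  rewrite [in RHS](row_sum_delta v) raddf_sum; apply: eq_bigr => j _.
  by rewrite !mxE eZ.
have key h v : Psi (tensor h v) = phi h *: e v by rewrite tensorE PsiZ Psi1.
clearbody Psi.
have Psi0 r : r \in span_mod (tensor_rel rE f) -> Psi r = 0.
  move/asboolP; elim=> [|h s t [h' b a v fba] _ IH].
    by rewrite -(subrr 0) PsiB subrr.
  by rewrite PsiD IH addr0 PsiZ PsiB !key rmorphM -scalerA (e_graph _ fba) subrr scaler0.
pose Phi (u : Ind) : Q := Psi (generic_quotient.repr u).
have PhiE r : Phi (quot_proj (span_mod (tensor_rel rE f)) r) = Psi r.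
  apply/eqP; rewrite -subr_eq0 -PsiB; apply/eqP/Psi0.
  by apply/quot_projP; rewrite {1}/quot_proj reprK.
have [u v|Phi' Phi'E] := @ex_additive _ _ Phi.
  have [r ->] := quot_proj_surj u; have [s ->] := quot_proj_surj v.
  by rewrite -raddfB !PhiE PsiB.
exists Phi'; split=> [h u|v]; last by rewrite Phi'E PhiE Psi1.
by have [r ->] := quot_proj_surj u; rewrite -linearZ !Phi'E !PhiE PsiZ.
Qed.
End Universal.
End InducedModules.

(** * The embedding of H into Ht *)
Section PresRelations.
Variables (F : fieldType) (G : choiceType) (R : free_alg F G -> free_alg F G -> Prop).

Lemma pres_rel p q : R p q -> pres_proj R p = pres_proj R q.
Proof.
move=> Rpq; apply/pres_projP.
rewrite -[p - q]mul1r -[1 * _]mulr1 -[X in in_ideal _ X]addr0.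
by constructor => //; constructor.
Qed.

Fact pres_const_zmod : zmod_morphism (fun c : F => c *: (1 : pres_alg R)).
Proof. by move=> a b; rewrite scalerBl. Qed.
Fact pres_const_monoid : monoid_morphism (fun c : F => c *: (1 : pres_alg R)).
Proof.
by split=> [|a b]; rewrite ?scale1r // -pres_scalerAl mul1r scalerA.
Qed.
Definition pres_const : {rmorphism F -> pres_alg R} :=
  HB.pack (fun c : F => c *: (1 : pres_alg R))
    (GRing.isZmodMorphism.Build _ _ _ pres_const_zmod)
    (GRing.isMonoidMorphism.Build _ _ _ pres_const_monoid).

Lemma pres_constE c : pres_const c = c *: (1 : pres_alg R). Proof. by []. Qed.

Lemma pres_constC c b : pres_const c * b = b * pres_const c.
Proof. exact: pres_alg_central. Qed.

Lemma pres_scale c b : c *: b = pres_const c * b.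
Proof. by rewrite pres_constE -pres_scalerAl mul1r. Qed.
End PresRelations.

(** The defining relations of the two algebras, seen through a morphism f from a
    ring A containing the generators. *)
Section Images.
Variables (A B : pzRingType) (f : {rmorphism A -> B}) (n : nat).
Variables (X U : 'I_n -> A) (W : 'S_n -> A) (kap : B).
Local Notation T i j := (W (tperm i j)).

Record smash_img : Prop := SmashImg {
  img_xx : forall i j, f (X i * X j) = f (X j * X i);
  img_w1 : f (W 1%g) = f 1;
  img_ww : forall a b, f (W b * W a) = f (W (a * b)%g);
  img_wx : forall (s : 'S_n) i, f (W s * X i * W s^-1%g) = f (X (s i)) }.

Lemma smash_imgP : smash_img <-> smash_sys (f \o X) (f \o W).
Proof.
split=> -[xx w1 ww wx]; split=> [i j||a b|s i] /=;
  move: (xx, w1, ww, wx) => -[[[{}xx {}w1] {}ww] {}wx].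
- by rewrite -!rmorphM xx.
- by rewrite w1 rmorph1.
- by rewrite -rmorphM ww.
- by rewrite -!rmorphM wx.
- by rewrite !rmorphM; apply: xx.
- by rewrite rmorph1; apply: w1.
- by rewrite rmorphM; apply: ww.
by rewrite !rmorphM; apply: wx.
Qed.

Record rat_img (K : A) : Prop := RatImg {
  img_rat_base : smash_img;
  img_yy : forall i j, f (U i * U j) = f (U j * U i);
  img_sy : forall i i' j : 'I_n, i' = i.+1 :> nat ->
    f (T i i' * U j) = f (U (tperm i i' j) * T i i');
  img_yx : forall i,
    f (commutator (U i) (X i)) = f (K + \sum_(k | k != i) T i k);
  img_yx' : forall i j, i != j -> f (commutator (U i) (X j)) = f (- T i j) }.

Lemma rmorph_commutator a b : f (commutator a b) = commutator (f a) (f b).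
Proof. by rewrite rmorphB !rmorphM. Qed.

Lemma rat_imgP K : f K = kap ->
  rat_img K <-> rat_sys kap (f \o X) (f \o W) (f \o U).
Proof.
move=> fK; split=> -[/smash_imgP bs yy sy yx yx']; split=> // *;
  move: yy sy yx yx' => yy sy yx yx' /=.
- by rewrite -!rmorphM yy.
- by rewrite -!rmorphM sy.
- by rewrite -rmorph_commutator yx rmorphD rmorph_sum fK.
- by rewrite -rmorph_commutator yx' // rmorphN.
- by rewrite !rmorphM; apply: yy.
- by rewrite !rmorphM; apply: sy.
- by rewrite rmorph_commutator rmorphD rmorph_sum fK; apply: yx.
by rewrite rmorph_commutator rmorphN; apply: yx'.
Qed.

Record trig_img (KX : 'I_n -> A) : Prop := TrigImg {
  img_trig_base : smash_img;
  img_uu : forall i j, f (U i * U j) = f (U j * U i);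
  img_su : forall i i' : 'I_n, i' = i.+1 :> nat ->
    f (T i i' * U i) = f (U i' * T i i' - 1);
  img_su' : forall i i' : 'I_n, i' = i.+1 :> nat ->
    f (T i i' * U i') = f (U i * T i i' + 1);
  img_su'' : forall i i' j : 'I_n, i' = i.+1 :> nat -> j != i -> j != i' ->
    f (T i i' * U j) = f (U j * T i i');
  img_ux : forall i, f (commutator (U i) (X i)) = f (KX i
      + \sum_(k : 'I_n | (k < i)%N) X k * T k i
      + \sum_(k : 'I_n | (i < k)%N) X i * T i k);
  img_ux_gt : forall i j : 'I_n, (j < i)%N ->
    f (commutator (U i) (X j)) = f (- (X j * T j i));
  img_ux_lt : forall i j : 'I_n, (i < j)%N ->
    f (commutator (U i) (X j)) = f (- (X i * T i j)) }.

Lemma trig_imgP KX : (forall i, f (KX i) = kap * f (X i)) ->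
  trig_img KX <-> trig_sys kap (f \o X) (f \o W) (f \o U).
Proof.
move=> fK.
have fS (P : pred 'I_n) (a b : 'I_n -> A) :
    f (\sum_(k | P k) a k * b k) = \sum_(k | P k) f (a k) * f (b k).
  by rewrite rmorph_sum; apply: eq_bigr => k _; rewrite rmorphM.
split=> -[/smash_imgP bs uu su su' su'' ux uxgt uxlt]; split=> // *;
  move: uu su su' su'' ux uxgt uxlt => uu su su' su'' ux uxgt uxlt /=.
- by rewrite -!rmorphM uu.
- by rewrite -!rmorphM su // rmorphB rmorph1.
- by rewrite -!rmorphM su' // rmorphD rmorph1.
- by rewrite -!rmorphM su''.
- by rewrite -rmorph_commutator ux !rmorphD !fS fK.
- by rewrite -rmorph_commutator uxgt // rmorphN rmorphM.
- by rewrite -rmorph_commutator uxlt // rmorphN rmorphM.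
- by rewrite !rmorphM; apply: uu.
- by rewrite rmorphB rmorph1 !rmorphM; apply: su.
- by rewrite rmorphD rmorph1 !rmorphM; apply: su'.
- by rewrite !rmorphM; apply: su''.
- by rewrite rmorph_commutator !rmorphD !fS fK; apply: ux.
- by rewrite rmorph_commutator rmorphN rmorphM; apply: uxgt.
by rewrite rmorph_commutator rmorphN rmorphM; apply: uxlt.
Qed.
End Images.

Section Evaluation.
Variables (F : fieldType) (n : nat) (kappa : F) (B : pzRingType).

Section Rational.
Variables (f : {rmorphism free_alg F (rat_index n) -> B}).
Let X i := free_gen F (@RatX n i).
Let W s := free_gen F (@RatW n s).
Let Y i := free_gen F (@RatY n i).

Lemma rat_rel_img : (forall p q, rat_rel kappa p q -> f p = f q) <->
  rat_img f X Y W (kappa *: 1).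
Proof.
split=> [E|[[xx w1 ww wx] yy sy yx yx'] p q].
  split; first split.
  - by move=> i j; exact: E (rat_xx kappa i j).
  - exact: E (rat_w1 n kappa).
  - by move=> u v; exact: E (rat_ww kappa u v).
  - by move=> s i; exact: E (rat_wx kappa s i).
  - by move=> i j; exact: E (rat_yy kappa i j).
  - by move=> i i' j ii'; exact: E (rat_sy kappa j ii').
  - by move=> i; exact: E (rat_yx kappa i).
  by move=> i j ij; exact: E (rat_yx' kappa ij).
case=> [i j||u v|s i|i j|i i' j ii'|i|i j ij].
- exact: xx.
- exact: w1.
- exact: ww.
- exact: wx.
- exact: yy.
- exact: sy.
- exact: yx.
exact: yx'.
Qed.
End Rational.

Section Trigonometric.
Variables (f : {rmorphism free_alg F (trig_index n) -> B}).
Let X i := free_gen F (@TrigX n i).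
Let W s := free_gen F (@TrigW n s).
Let U i := free_gen F (@TrigU n i).

Lemma trig_rel_img : (forall p q, trig_rel kappa p q -> f p = f q) ->
  trig_img f X U W (fun i => kappa *: X i).
Proof.
move=> E; split; first split.
- by move=> i j; exact: E (trig_xx kappa i j).
- exact: E (trig_w1 n kappa).
- by move=> u v; exact: E (trig_ww kappa u v).
- by move=> s i; exact: E (trig_wx kappa s i).
- by move=> i j; exact: E (trig_uu kappa i j).
- by move=> i i' ii'; exact: E (trig_su kappa ii').
- by move=> i i' ii'; exact: E (trig_su' kappa ii').
- by move=> i i' j ii' ji ji'; exact: E (trig_su'' kappa ii' ji ji').
- by move=> i; exact: E (trig_ux kappa i).
- by move=> i j ij; exact: E (trig_ux_gt kappa ij).
by move=> i j ij; exact: E (trig_ux_lt kappa ij).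
Qed.

Lemma trig_img_rel : trig_img f X U W (fun i => kappa *: X i) ->
  forall p q, trig_rel kappa p q -> f p = f q \/ exists i,
    (p = free_gen F (TrigX i) * free_gen F (TrigXV i) \/
     p = free_gen F (TrigXV i) * free_gen F (TrigX i)) /\ q = 1.
Proof.
case=> [[xx w1 ww wx] uu su su' su'' ux uxgt uxlt] p q.
case=> [i j|i|i||a b|s i|i j|i i' ii'|i i' ii'|i i' j ii' ji ji'|i|i j ij|i j ij].
- by left; exact: xx.
- by right; exists i; split=> //; left.
- by right; exists i; split=> //; right.
- by left; exact: w1.
- by left; exact: ww.
- by left; exact: wx.
- by left; exact: uu.
- by left; exact: su.
- by left; exact: su'.
- by left; exact: su''.
- by left; exact: ux.
- by left; exact: uxgt.
by left; exact: uxlt.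
Qed.
End Trigonometric.
End Evaluation.

Section Algebras.
Variables (F : fieldType) (n : nat) (kappa : F).
Local Notation H := (rat_cherednik n kappa).
Local Notation Ht := (trig_cherednik n kappa).
Local Notation rat_const := (pres_const (@rat_rel F n kappa)).
Local Notation trig_const := (pres_const (@trig_rel F n kappa)).

Definition rX i : H := rat_gen kappa (RatX i).
Definition rW s : H := rat_gen kappa (RatW s).
Definition rY i : H := rat_gen kappa (RatY i).
Definition tX i : Ht := trig_gen kappa (TrigX i).
Definition tXV i : Ht := trig_gen kappa (TrigXV i).
Definition tW s : Ht := trig_gen kappa (TrigW s).
Definition tU i : Ht := trig_gen kappa (TrigU i).
Definition rkap : H := rat_const kappa.
Definition tkap : Ht := trig_const kappa.

Lemma rkapC b : rkap * b = b * rkap. Proof. exact: pres_constC. Qed.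
Lemma tkapC b : tkap * b = b * tkap. Proof. exact: pres_constC. Qed.

Lemma rat_alg_sys : rat_sys rkap rX rW rY.
Proof.
apply/(@rat_imgP _ _ (pres_proj (@rat_rel F n kappa)) _ _ _ _ rkap (kappa *: 1)).
  rewrite /rkap pres_constE -(rmorph1 (pres_proj (@rat_rel F n kappa))); exact: linearZ.
by apply/rat_rel_img => p q; apply: pres_rel.
Qed.

Lemma trig_alg_sys : trig_sys tkap tX tW tU.
Proof.
apply/(@trig_imgP _ _ (pres_proj (@trig_rel F n kappa)) _ _ _ _ tkap
  (fun i => kappa *: free_gen F (@TrigX n i))) => [i|].
  by rewrite -pres_scale; exact: linearZ.
by apply: trig_rel_img => p q; apply: pres_rel.
Qed.

Lemma tXXV i : tX i * tXV i = 1.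
Proof.
apply: etrans (esym (rmorphM _ _ _)) (etrans (pres_rel (trig_xxV kappa i)) (rmorph1 _)).
Qed.
Lemma tXVX i : tXV i * tX i = 1.
Proof.
apply: etrans (esym (rmorphM _ _ _)) (etrans (pres_rel (trig_xVx kappa i)) (rmorph1 _)).
Qed.

(** The elements of H and Ht that correspond to u_i and to x_i y_i. *)
Definition rU i : H := rX i * rY i + jm rW i.
Definition tZ i : Ht := tU i - jm tW i.

Lemma rU_sys : trig_sys rkap rX rW rU.
Proof.
apply/(trig_z _ (rat_base rat_alg_sys) (fun i => erefl (rU i))).
exact/(rat_to_z rkapC)/rat_alg_sys.
Qed.

Lemma tY_sys : rat_sys tkap tX tW (fun i => tXV i * tZ i).
Proof.
apply: (z_to_rat tkapC tXXV tXVX).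
by apply/(trig_z _ (trig_base trig_alg_sys) _)/trig_alg_sys => i; rewrite subrK.
Qed.

Record is_iota (iota : {rmorphism H -> Ht}) : Prop := IsIota {
  iotaX : forall i, iota (rX i) = tX i;
  iotaW : forall s, iota (rW s) = tW s;
  iotaY : forall i, iota (rY i) = tXV i * tZ i;
  iotaC : forall c, iota (rat_const c) = trig_const c }.

Lemma ex_iota : exists iota, is_iota iota.
Proof.
pose g (a : rat_index n) : Ht := match a with
  | RatX i => tX i | RatW s => tW s | RatY i => tXV i * tZ i end.
have [f [fg fc]] := free_univ (fun c a => @pres_constC _ _ (@trig_rel F n kappa) c (g a)).
have [|f' f'E] := @pres_factor _ _ (@rat_rel F n kappa) _ f.
  apply/rat_rel_img/(@rat_imgP _ _ f _ _ _ _ tkap); first by rewrite fc rmorph1 mulr1.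
  have -> : f \o (fun i => free_gen F (@RatX n i)) = tX by apply/funext => i; apply: fg.
  have -> : f \o (fun i => free_gen F (@RatW n i)) = tW by apply/funext => i; apply: fg.
  have -> : f \o (fun i => free_gen F (@RatY n i)) = (fun i => tXV i * tZ i).
    by apply/funext => i; apply: fg.
  exact: tY_sys.
exists f'; split=> [i|w|i|c].
- by rewrite [LHS]f'E fg.
- by rewrite [LHS]f'E fg.
- by rewrite [LHS]f'E fg.
rewrite pres_constE -(rmorph1 (pres_proj (@rat_rel F n kappa))) -linearZ.
by rewrite [LHS]f'E fc rmorph1 mulr1.
Qed.

Variable iota : {rmorphism H -> Ht}.
Hypothesis io : is_iota iota.

Definition rat_p : H := xfull rX.
Definition trig_p : Ht := xfull tX.
Definition rat_Y : H := \sum_i rY i.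

Lemma iota_kap : iota rkap = tkap. Proof. exact: (iotaC io). Qed.

Lemma iota_jm i : iota (jm rW i) = jm tW i.
Proof. by rewrite rmorph_sum; apply: eq_bigr => k _; rewrite (iotaW io). Qed.

Lemma iota_u i : iota (rU i) = tU i.
Proof.
rewrite rmorphD rmorphM (iotaX io) (iotaY io) iota_jm.
by rewrite mulrA tXXV mul1r subrK.
Qed.

Lemma iota_xprod l : iota (xprod rX l) = xprod tX l.
Proof. by rewrite rmorph_prod; apply: eq_bigr => i _; rewrite (iotaX io). Qed.

Lemma iota_p : iota rat_p = trig_p. Proof. exact: iota_xprod. Qed.

Lemma ex_pV : exists pV, pV * iota rat_p = 1 /\ iota rat_p * pV = 1.
Proof. by rewrite iota_p; apply: xprod_inv; [exact: tXXV | exact: tXVX]. Qed.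

Lemma trig_alg_ind (P : Ht -> Prop) : (forall c, P (trig_const c)) ->
  (forall i, P (tX i)) -> (forall i, P (tXV i)) -> (forall s, P (tW s)) ->
  (forall i, P (tU i)) -> (forall a b, P a -> P b -> P (a + b)) ->
  (forall a b, P a -> P b -> P (a * b)) -> forall a, P a.
Proof.
move=> Pc PX PXV PW PU PD PM; apply: pres_alg_ind; [exact: Pc | | exact: PD | exact: PM].
case=> [i|i|s|i]; [exact: PX | exact: PXV | exact: PW | exact: PU].
Qed.

Lemma rat_alg_ind (P : H -> Prop) : (forall c, P (rat_const c)) ->
  (forall i, P (rX i)) -> (forall s, P (rW s)) ->
  (forall i, P (rY i)) -> (forall a b, P a -> P b -> P (a + b)) ->
  (forall a b, P a -> P b -> P (a * b)) -> forall a, P a.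
Proof.
move=> Pc PX PW PY PD PM; apply: pres_alg_ind; [exact: Pc | | exact: PD | exact: PM].
case=> [i|s|i]; [exact: PX | exact: PW | exact: PY].
Qed.

Lemma ore_iota b k : exists k' a, iota rat_p ^+ k' * b = iota a * iota rat_p ^+ k.
Proof.
exact: (ore_of_generators tkapC (@pres_constC F _ (@trig_rel F n kappa))
  tXXV trig_alg_sys (iotaX io) (iotaW io) iota_u
  (iotaC io) iota_kap trig_alg_ind b k).
Qed.

Hypotheses (charF0 : [pchar F] =i pred0) (kappa_neq0 : kappa != 0).

Lemma kappa_nat k : kappa *+ k.+1 != 0.
Proof.
rewrite -mulr_natr mulf_eq0 (negPf kappa_neq0) /=.
by move/pcharf0P: charF0 => ->.
Qed.

Lemma rkapV k : exists c, c * (rkap *+ k.+1) = 1.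
Proof.
exists (rat_const (kappa *+ k.+1)^-1).
by rewrite /rkap -rmorphMn -rmorphM mulVf ?kappa_nat // rmorph1.
Qed.

Lemma saturating_rat (R : pzRingType) (phi : {rmorphism H -> R}) :
  saturating rat_p rat_Y phi.
Proof.
move=> V N NB NZ v K k; apply: (saturating_xfull rkapC rkapV _ NB NZ).
by move=> i; apply: (commutator_Yx _ rat_alg_sys).
Qed.

End Algebras.

(** * A module over Ht that contains a given H-module *)
Section ModuleOfMorphism.
Variables (A : pzRingType) (V : zmodType).
Definition mod_of of {rmorphism A -> endo V} : Type := V.
Variable rho : {rmorphism A -> endo V}.
Local Notation mod_rho := (mod_of rho).
HB.instance Definition _ := GRing.Zmodule.on mod_rho.
Definition mod_of_scale (a : A) (v : mod_rho) : mod_rho := rho a v.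
Fact mod_of_scaleA a b v : mod_of_scale a (mod_of_scale b v) = mod_of_scale (a * b) v.
Proof. by rewrite /mod_of_scale rmorphM. Qed.
Fact mod_of_scale1 : left_id 1 mod_of_scale.
Proof. by move=> v; rewrite /mod_of_scale rmorph1. Qed.
Fact mod_of_scaleDr : right_distributive mod_of_scale +%R.
Proof. by move=> a u v; rewrite /mod_of_scale raddfD. Qed.
Fact mod_of_scaleDl v : {morph mod_of_scale^~ v : a b / a + b}.
Proof. by move=> a b; rewrite /mod_of_scale rmorphD. Qed.
HB.instance Definition _ := GRing.Zmodule_isLmodule.Build A mod_rho
  mod_of_scaleA mod_of_scale1 mod_of_scaleDr mod_of_scaleDl.
Lemma mod_ofE a (v : mod_rho) : a *: v = rho a v. Proof. by []. Qed.
End ModuleOfMorphism.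

Section LmodEndo.
Variables (A : pzRingType) (V : lmodType A).
Fact lmod_endo_sub (a : A) : zmod_morphism (fun v : V => a *: v).
Proof. by move=> u v; rewrite scalerBr. Qed.
Definition lmod_endo (a : A) : endo V := Endo (lmod_endo_sub a).
Fact lmod_endo_zmod : zmod_morphism lmod_endo.
Proof. by move=> a b; apply: endoP => v /=; rewrite scalerBl. Qed.
Fact lmod_endo_monoid : monoid_morphism lmod_endo.
Proof.
by split=> [|a b]; apply: endoP => v /=; rewrite ?scale1r ?scalerA.
Qed.
Definition lmod_rho : {rmorphism A -> endo V} := HB.pack lmod_endo
  (GRing.isZmodMorphism.Build _ _ _ lmod_endo_zmod)
  (GRing.isMonoidMorphism.Build _ _ _ lmod_endo_monoid).
Lemma lmod_rhoE a v : lmod_rho a v = a *: v. Proof. by []. Qed.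
End LmodEndo.

Lemma trig_sys_fun (T : Type) (B : pzRingType) n (kap : B) (x : 'I_n -> B)
    (w : 'S_n -> B) (u : T -> 'I_n -> B) :
  smash_sys x w -> (forall k, trig_sys kap x w (u k)) ->
  trig_sys (fun=> kap : B) (fun i (_ : T) => x i) (fun s (_ : T) => w s)
    (fun i k => u k i).
Proof.
move=> bs ts; split; first split.
- by move=> i j; apply/funext => k; apply: (smash_xx bs).
- by apply/funext => k; apply: (smash_w1 bs).
- by move=> a b; apply/funext => k; apply: (smash_ww bs).
- by move=> s i; apply/funext => k; apply: (smash_wx bs).
- by move=> i j; apply/funext => k; apply: (trigS_uu (ts k)).
- by move=> i i' ii'; apply/funext => k; apply: (trigS_su (ts k)).
- by move=> i i' ii'; apply/funext => k; apply: (trigS_su' (ts k)).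
- by move=> i i' j ii' ji ji'; apply/funext => k; apply: (trigS_su'' (ts k)).
- move=> i; apply/funext => k; apply: etrans (trigS_ux (ts k) i) _.
  by apply: (congr2 +%R (congr2 +%R (erefl _) _) _); rewrite fct_sumE.
- by move=> i j ij; apply/funext => k; apply: (trigS_ux_gt (ts k)).
by move=> i j ij; apply/funext => k; apply: (trigS_ux_lt (ts k)).
Qed.

Lemma trig_sys_morph (A B : pzRingType) (f : {rmorphism A -> B}) n (kap : A)
    (x u : 'I_n -> A) (w : 'S_n -> A) :
  trig_sys kap x w u -> trig_sys (f kap) (f \o x) (f \o w) (f \o u).
Proof.
case=> -[xx w1 ww wx] uu su su' su'' ux uxgt uxlt.
apply/(@trig_imgP _ _ f _ _ _ _ _ (fun i => kap * x i)) => [i|]; first exact: rmorphM.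
split; first split.
- by move=> i j; rewrite xx.
- by rewrite w1.
- by move=> a b; rewrite ww.
- by move=> s i; rewrite wx.
- by move=> i j; rewrite uu.
- by move=> i i' ii'; rewrite su.
- by move=> i i' ii'; rewrite su'.
- by move=> i i' j ii' ji ji'; rewrite su''.
- by move=> i; rewrite ux.
- by move=> i j ij; rewrite uxgt.
by move=> i j ij; rewrite uxlt.
Qed.

Section DiagonalOperators.
Variables (A : pzRingType) (M : lmodType A).
Local Notation S := (nat -> M).
Fact diag_sub (a : nat -> A) : zmod_morphism (fun (m : S) k => a k *: m k).
Proof. by move=> m m'; apply/funext => k; apply: scalerBr. Qed.
Definition diag_fun (a : nat -> A) : endo S := Endo (diag_sub a).
Fact diag_zmod : zmod_morphism diag_fun.
Proof. by move=> a b; apply: endoP => m; apply/funext => k; apply: scalerBl. Qed.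
Fact diag_monoid : monoid_morphism diag_fun.
Proof.
split=> [|a b]; apply: endoP => m; apply/funext => k; first exact: scale1r.
by apply: esym; apply: scalerA.
Qed.
Definition diag : {rmorphism (nat -> A) -> endo S} := HB.pack diag_fun
  (GRing.isZmodMorphism.Build _ _ _ diag_zmod)
  (GRing.isMonoidMorphism.Build _ _ _ diag_monoid).
Lemma diagE a m k : diag a m k = a k *: m k. Proof. by []. Qed.

Fact shift_sub (a : A) : zmod_morphism (fun (m : S) k =>
  if k is k'.+1 then a *: m k' else 0).
Proof.
move=> m m'; apply/funext => -[|k]; last exact: scalerBr.
by apply: esym; apply: subrr.
Qed.
Definition shift (a : A) : endo S := Endo (shift_sub a).
Lemma shiftE a m k : shift a m k = if k is k'.+1 then a *: m k' else 0.
Proof. by []. Qed.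
End DiagonalOperators.

(** The generators of Ht act on sequences in M so that, if m is the sequence
    p^k v for some v in M[1/p] and for large k, then its image by a generator g
    is the sequence p^k (g v). *)
Section LocalizedModule.
Variables (F : fieldType) (n : nat) (kappa : F) (A : pzRingType).
Variables (cA : {rmorphism F -> A}) (x u : 'I_n -> A) (w : 'S_n -> A).
Hypothesis cAC : forall c a, cA c * a = a * cA c.
Local Notation ka := (cA kappa).
Local Notation p := (xfull x).
Hypothesis ts : trig_sys ka x w u.
Let bs := trig_base ts.
Variable M : lmodType A.
Local Notation S := (nat -> M).
Local Notation free := (free_alg F (trig_index n)).

(** Since p^k u = (u - k kappa) p^k, u acts with a shift depending on the index.
    As p^(k+1) x_i^-1 = (p / x_i) p^k, the inverse of x_i moves the sequence one
    step to the right; the entry 0 is arbitrary, as only germs matter. *)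
Definition seq_op (a : trig_index n) : endo S :=
  match a with
  | TrigX i => diag M (fun=> x i)
  | TrigXV i => shift M (xbut x i)
  | TrigW s => diag M (fun=> w s)
  | TrigU i => diag M (fun k => u i - ka *+ k)
  end.

Fact seq_const_zmod : zmod_morphism (fun c : F => diag M (fun=> cA c)).
Proof.
move=> a b; apply: endoP => m; apply/funext => k.
by rewrite diagE rmorphB; apply: scalerBl.
Qed.
Fact seq_const_monoid : monoid_morphism (fun c : F => diag M (fun=> cA c)).
Proof.
split=> [|a b]; apply: endoP => m; apply/funext => k; rewrite diagE.
  by rewrite rmorph1; apply: scale1r.
by rewrite rmorphM; apply: esym; apply: scalerA.
Qed.
Definition seq_const : {rmorphism F -> endo S} := HB.pack
  (fun c : F => diag M (fun=> cA c))
  (GRing.isZmodMorphism.Build _ _ _ seq_const_zmod)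
  (GRing.isMonoidMorphism.Build _ _ _ seq_const_monoid).
Lemma seq_constE c m k : seq_const c m k = cA c *: m k. Proof. by []. Qed.

Lemma seq_constC c a : seq_const c * seq_op a = seq_op a * seq_const c.
Proof.
apply: endoP => m; apply/funext => k; rewrite -[LHS]/(cA c *: seq_op a m k).
rewrite -[RHS]/(seq_op a (seq_const c m) k).
case: a => [i|i|s|i] /=; try by rewrite !scalerA cAC.
by case: k => [|k]; rewrite ?scaler0 // !scalerA cAC.
Qed.

(** The sequences that are of the form p^k v from some index on, and those that
    represent v = 0. *)
Definition seq_compat (m : S) := exists K, forall k, (K <= k)%N -> m k.+1 = p *: m k.
Definition seq_null (m : S) := exists K, forall k, (K <= k)%N -> m k = 0.

Lemma xfull_xbut i : p * xbut x i = xbut x i * p.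
Proof. by rewrite {1}(xfullE' bs i) -mulrA -(xfullE bs i). Qed.

Lemma kaXC k b : (ka *+ k) * b = b * (ka *+ k).
Proof. by rewrite -rmorphMn cAC. Qed.

Lemma seq_op_compat a m : seq_compat m -> seq_compat (seq_op a m).
Proof.
case=> K mK; case: a => [i|i|s|i].
- by exists K => k Kk; rewrite !diagE mK // !scalerA (xprod_x bs).
- by exists K.+1 => -[|k] // Kk; rewrite !shiftE mK // !scalerA xfull_xbut.
- by exists K => k Kk; rewrite !diagE mK // !scalerA (w_xfull bs).
exists K => k Kk; rewrite !diagE mK // !scalerA.
suff -> : (u i - ka *+ k.+1) * p = p * (u i - ka *+ k) by [].
by rewrite mulrBr (xfull_u (cAC _) ts) -kaXC -mulrBl mulrSr opprD addrA addrAC.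
Qed.

Lemma seq_op_null a m : seq_null m -> seq_null (seq_op a m).
Proof.
case=> K mK; case: a => [i|i|s|i].
- by exists K => k Kk; rewrite diagE mK // scaler0.
- by exists K.+1 => -[|k] // Kk; rewrite shiftE mK // scaler0.
- by exists K => k Kk; rewrite diagE mK // scaler0.
by exists K => k Kk; rewrite diagE mK // scaler0.
Qed.

Lemma seq_compatD m m' : seq_compat m -> seq_compat m' -> seq_compat (m + m').
Proof.
case=> K mK [K' mK']; exists (maxn K K') => k; rewrite geq_max => /andP[Kk Kk'].
by rewrite -[LHS]/(m k.+1 + m' k.+1) mK // mK' // -scalerDr.
Qed.
Lemma seq_nullD m m' : seq_null m -> seq_null m' -> seq_null (m + m').
Proof.
case=> K mK [K' mK']; exists (maxn K K') => k; rewrite geq_max => /andP[Kk Kk'].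
by rewrite -[LHS]/(m k + m' k) mK // mK' // addr0.
Qed.

Lemma seq_sys : trig_sys (seq_const kappa) (fun i => seq_op (TrigX i))
  (fun s => seq_op (TrigW s)) (fun i => seq_op (TrigU i)).
Proof.
have ts' k : trig_sys ka x w (fun i => u i - ka *+ k).
  by apply: (trig_shift ts) => b; apply: kaXC.
exact: (trig_sys_morph (diag M) (trig_sys_fun bs ts')).
Qed.

Section Action.
Variable f : {rmorphism free -> endo S}.
Hypotheses (fg : forall a, f (free_gen F a) = seq_op a)
  (fc : forall c a, f (c *: a) = seq_const c * f a).

Lemma action_ind (P : endo S -> Prop) : (forall c, P (seq_const c)) ->
  (forall a, P (seq_op a)) -> (forall a b, P a -> P b -> P (a + b)) ->
  (forall a b, P a -> P b -> P (a * b)) -> forall a, P (f a).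
Proof.
move=> Pc Pg PD PM; apply: free_alg_ind.
- by move=> c; rewrite fc rmorph1 mulr1.
- by move=> a; rewrite fg.
- by move=> a b; rewrite rmorphD; apply: PD.
by move=> a b; rewrite rmorphM; apply: PM.
Qed.

Lemma action_compat a m : seq_compat m -> seq_compat (f a m).
Proof.
move: m; elim/action_ind: (f a) => [c|b|b c Hb Hc|b c Hb Hc] m mc.
- case: mc => K mK; exists K => k Kk.
  by rewrite !seq_constE mK // !scalerA cAC.
- exact: seq_op_compat.
- by apply: seq_compatD; [apply: Hb | apply: Hc].
by apply: Hb; apply: Hc.
Qed.

Lemma action_null a m : seq_null m -> seq_null (f a m).
Proof.
move: m; elim/action_ind: (f a) => [c|b|b c Hb Hc|b c Hb Hc] m mc.
- by case: mc => K mK; exists K => k Kk; rewrite !seq_constE mK // scaler0.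
- exact: seq_op_null.
- by apply: seq_nullD; [apply: Hb | apply: Hc].
by apply: Hb; apply: Hc.
Qed.

(** All relations hold on the nose, index by index, except those between x_i and
    its inverse, which hold from some index on. *)
Lemma action_rel r r' m :
  trig_rel kappa r r' -> seq_compat m -> seq_null (f r m - f r' m).
Proof.
move=> Rrr' [K mK].
have [|E|[i [E ->]]] := @trig_img_rel F n kappa _ f _ r r' Rrr'.
- apply/(@trig_imgP _ _ f _ _ _ _ (seq_const kappa)); first by move=> i; exact: fc.
  have -> : f \o (fun i => free_gen F (@TrigX n i)) = fun i => seq_op (TrigX i).
    by apply/funext => i; apply: fg.
  have -> : f \o (fun i => free_gen F (@TrigW n i)) = fun i => seq_op (TrigW i).
    by apply/funext => i; apply: fg.
  have -> : f \o (fun i => free_gen F (@TrigU n i)) = fun i => seq_op (TrigU i).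
    by apply/funext => i; apply: fg.
  exact: seq_sys.
- by exists 0%N => k _; rewrite E subrr.
exists K.+1 => -[|k] // Kk; rewrite rmorph1.
have E' : f r m k.+1 = m k.+1.
  case: E => ->; rewrite rmorphM !fg mK //.
    by rewrite -[LHS]/(x i *: (xbut x i *: m k)) scalerA -(xfullE bs).
  by rewrite -[LHS]/(xbut x i *: (x i *: m k)) scalerA -(xfullE' bs).
by rewrite -[LHS]/(f r m k.+1 - m k.+1) E' subrr.
Qed.

End Action.
End LocalizedModule.

(** A map compatible with x, w and u is compatible with y = x^-1 (u - jm). *)
Section Equivariance.
Variables (C : Type) (A B : pzRingType) (n : nat) (cA : C -> A) (cB : C -> B).
Variables (x y u : 'I_n -> A) (w : 'S_n -> A).
Hypothesis uE : forall i, u i = x i * y i + jm w i.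
Hypothesis indA : forall P : A -> Prop, (forall c, P (cA c)) ->
  (forall i, P (x i)) -> (forall s, P (w s)) -> (forall i, P (y i)) ->
  (forall a b, P a -> P b -> P (a + b)) ->
  (forall a b, P a -> P b -> P (a * b)) -> forall a, P a.
Variables (X XV U : 'I_n -> B) (W : 'S_n -> B).
Hypothesis XVX : forall i, XV i * X i = 1.
Variable iota : {rmorphism A -> B}.
Hypotheses (ioX : forall i, iota (x i) = X i) (ioW : forall s, iota (w s) = W s)
  (ioU : forall i, iota (u i) = U i) (ioC : forall c, iota (cA c) = cB c).

Lemma equivariant_gens (M : lmodType A) (Q : lmodType B) (j : {additive M -> Q}) :
  (forall c m, j (cA c *: m) = cB c *: j m) ->
  (forall i m, j (x i *: m) = X i *: j m) ->
  (forall s m, j (w s *: m) = W s *: j m) ->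
  (forall i m, j (u i *: m) = U i *: j m) ->
  forall a m, j (a *: m) = iota a *: j m.
Proof.
move=> jc jx jw ju; apply: indA => [c|i|s|i|a b Ha Hb|a b Ha Hb] m.
- by rewrite ioC.
- by rewrite ioX.
- by rewrite ioW.
- have jjm m' : j (jm w i *: m') = iota (jm w i) *: j m'.
    rewrite /jm rmorph_sum !scaler_suml raddf_sum; apply: eq_bigr => k _.
    by rewrite jw ioW.
  have E : X i *: j (y i *: m) = X i *: (iota (y i) *: j m).
    rewrite -jx !scalerA -ioX -rmorphM.
    have -> : x i * y i = u i - jm w i by rewrite uE addrK.
    by rewrite rmorphB !scalerBl (raddfB j) ju jjm ioU.
  have := congr1 (fun v => XV i *: v) E; rewrite !scalerA XVX mul1r.
  by rewrite scale1r.
- by rewrite scalerDl raddfD Ha Hb rmorphD scalerDl.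
by rewrite -scalerA Ha Hb rmorphM scalerA.
Qed.
End Equivariance.

Section ExistsLocalization.
Variables (F : fieldType) (n : nat) (kappa : F) (A : pzRingType).
Local Notation Ht := (trig_cherednik n kappa).
Local Notation trel := (@trig_rel F n kappa).
Local Notation tX := (@tX F n kappa).
Local Notation tXV := (@tXV F n kappa).
Local Notation tW := (@tW F n kappa).
Local Notation tU := (@tU F n kappa).
Variables (cA : {rmorphism F -> A}) (x u : 'I_n -> A) (w : 'S_n -> A).
Hypothesis cAC : forall c a, cA c * a = a * cA c.
Local Notation ka := (cA kappa).
Local Notation p := (xfull x).
Hypothesis ts : trig_sys ka x w u.
Variable M : lmodType A.
Hypothesis p_inj : forall m : M, p *: m = 0 -> m = 0.
Let bs := trig_base ts.
Local Notation S := (nat -> M).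

Lemma xfullX_inj k (m : M) : p ^+ k *: m = 0 -> m = 0.
Proof.
elim: k => [|k IH]; first by rewrite scale1r.
by rewrite exprS -scalerA => /p_inj/IH.
Qed.

Definition powers (m : M) : S := fun k => p ^+ k *: m.

Lemma powers_compat m : seq_compat x (powers m).
Proof. by exists 0%N => k _; rewrite /powers exprS -scalerA. Qed.

(** Compatible sequences modulo null ones; m is sent to the germ of p^k m. *)
Lemma ex_localization : exists (Q : lmodType Ht) (j : {additive M -> Q}),
  [/\ forall c m, j (cA c *: m) = pres_const trel c *: j m,
      forall i m, j (x i *: m) = tX i *: j m,
      forall s m, j (w s *: m) = tW s *: j m,
      forall i m, j (u i *: m) = tU i *: j m &
      forall m, j m = 0 -> m = 0].
Proof.
have [f [fg fc]] := free_univ (seq_constC kappa x u w cAC M).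
pose S1 : lmodType _ := mod_of f.
have [||a v|P PE] := @ex_submod _ S1 (@seq_compat _ _ x M).
- by exists 0%N => k _; rewrite scaler0.
- exact: seq_compatD.
- exact: (action_compat cAC ts fg fc).
have [||a v|N NE] := @ex_submod _ S1 (@seq_null _ M).
- by exists 0%N.
- exact: seq_nullD.
- exact: (action_null fg fc).
pose Q0 := subquot_mod N P.
have [r r' Rrr'|rho rhoE] := @pres_factor _ _ trel _ (lmod_rho Q0).
  apply: endoP => t; have [s ->] := quot_proj_surj t; rewrite !lmod_rhoE -!linearZ.
  apply/quot_projP; rewrite in_trace; apply/NE.
  exact: (action_rel cAC ts fg fc Rrr' (iffLR (PE _) (valP s))).
pose Q : lmodType Ht := mod_of rho.
have Pw m : powers m \in P by apply/PE/powers_compat.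
pose js m : sub_mod P := exist _ (powers m) (Pw m).
pose J m : Q0 := quot_proj (@trace_mod _ _ N P) (js m).
have JB m m' : J (m - m') = J m - J m'.
  rewrite /J -raddfB; congr quot_proj; apply: val_inj; apply/funext => k.
  exact: scalerBr.
have [j jE] := @ex_additive M Q J JB.
(* equality as sequences, rather than as germs, is enough for x, w and u *)
have act r m m' : f r (powers m) = powers m' -> j m' = (pres_proj trel r : Ht) *: j m.
  move=> E; rewrite !jE mod_ofE rhoE lmod_rhoE /J -linearZ; congr quot_proj.
  by apply: val_inj.
exists Q, j; split=> [c m|i m|s m|i m|m].
- rewrite pres_constE -(rmorph1 (pres_proj trel)) -linearZ; apply: act.
  rewrite fc rmorph1 mulr1; apply/funext => k.
  by rewrite seq_constE /powers !scalerA cAC.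
- apply: act; rewrite fg; apply/funext => k.
  rewrite diagE /powers !scalerA; congr (_ *: _).
  by apply: commrX; apply: esym; apply: (xprod_x bs).
- apply: act; rewrite fg; apply/funext => k.
  by rewrite diagE /powers !scalerA; congr (_ *: _); apply: commrX; apply: (w_xfull bs).
- apply: act; rewrite fg; apply/funext => k.
  by rewrite diagE /powers !scalerA (xfullX_u (cAC _) ts).
rewrite jE -(raddf0 (quot_proj (@trace_mod _ _ N P))) => /quot_projP.
rewrite subr0 in_trace => /NE [K /(_ K (leqnn K))]; exact: xfullX_inj.
Qed.
End ExistsLocalization.

(** * Standard modules *)
Section JucysMurphyAction.
Variables (F : fieldType) (n d : nat) (rE : mx_representation F [set: 'S_n] d).

Definition jm_mx (i : 'I_n) : 'M[F]_d := \sum_(k : 'I_n | (k < i)%N) rE (tperm k i).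

Lemma jm_act (B : pzRingType) (Q : lmodType B) (w : 'S_n -> B)
    (e : {additive 'rV[F]_d -> Q}) :
  (forall s v, w s *: e v = e (v *m rE s)) ->
  forall i v, jm w i *: e v = e (v *m jm_mx i).
Proof.
move=> we i v; rewrite scaler_suml mulmx_sumr raddf_sum.
by apply: eq_bigr => k _; rewrite we.
Qed.

Lemma gring_op_jm (i : 'I_n) : gring_op rE
  (\sum_(j : 'I_n | (j < i)%N) regular_repr F [set: 'S_n] (tperm j i)) = jm_mx i.
Proof. by rewrite linear_sum; apply: eq_bigr => k _; apply: gring_opG; rewrite inE. Qed.

(** The matrices rE act on the right; composing with the inverse makes them a left
    action, and transpositions are their own inverses. *)
Lemma sum_jm_cent : centgmx rE (\sum_i jm_mx i).
Proof.
pose wE (s : 'S_n) : 'M[F]_d := rE s^-1%g.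
have bs : smash_sys (B := 'M[F]_d) (fun _ : 'I_n => 0) wE.
  split=> [i j||a b|s i]; rewrite ?mulr0 ?mul0r //.
    by rewrite /wE invg1 repr_mx1.
  by rewrite /wE invMg repr_mxM ?inE.
apply/centgmxP => s _; have := sum_jm_w bs s^-1%g.
have -> : \sum_i jm wE i = \sum_i jm_mx i.
  by apply: eq_bigr => i _; apply: eq_bigr => k _; rewrite /wE tpermV.
by rewrite /wE invgK => /esym E; exact: E.
Qed.
End JucysMurphyAction.

(** M is generated by a copy of the representation rE on which the y's act as zero
    (resp. the u's as Jucys-Murphy elements), and is universal for that. *)
Section InducedFrom.
Variables (F : fieldType) (n d : nat) (rE : mx_representation F [set: 'S_n] d).
Variables (A : pzRingType) (c : F -> A) (w : 'S_n -> A) (y : 'I_n -> A).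
Variables (M : lmodType A) (e : {additive 'rV[F]_d -> M}).

Record rat_induced : Prop := RatInduced {
  rat_ind_Z : forall a v, e (a *: v) = c a *: e v;
  rat_ind_w : forall s v, w s *: e v = e (v *m rE s);
  rat_ind_y : forall i v, y i *: e v = 0;
  rat_ind_gen : forall P : M -> Prop, P 0 ->
    (forall a b, P a -> P b -> P (a + b)) -> (forall h v, P (h *: e v)) ->
    forall m, P m;
  rat_ind_univ : forall (C : pzRingType) (phi : {rmorphism A -> C})
      (Q : lmodType C) (e' : {additive 'rV[F]_d -> Q}),
    (forall a v, e' (a *: v) = phi (c a) *: e' v) ->
    (forall s v, phi (w s) *: e' v = e' (v *m rE s)) ->
    (forall i v, phi (y i) *: e' v = 0) ->
    exists Phi : {additive M -> Q},
      (forall h u, Phi (h *: u) = phi h *: Phi u) /\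
      (forall v, Phi (e v) = e' v) }.

Record trig_induced : Prop := TrigInduced {
  trig_ind_Z : forall a v, e (a *: v) = c a *: e v;
  trig_ind_w : forall s v, w s *: e v = e (v *m rE s);
  trig_ind_u : forall i v, y i *: e v = e (v *m jm_mx rE i);
  trig_ind_gen : forall P : M -> Prop, P 0 ->
    (forall a b, P a -> P b -> P (a + b)) -> (forall h v, P (h *: e v)) ->
    forall m, P m;
  trig_ind_univ : forall (Q : lmodType A) (e' : {additive 'rV[F]_d -> Q}),
    (forall a v, e' (a *: v) = c a *: e' v) ->
    (forall s v, w s *: e' v = e' (v *m rE s)) ->
    (forall i v, y i *: e' v = e' (v *m jm_mx rE i)) ->
    exists Phi : {additive M -> Q},
      (forall h u, Phi (h *: u) = h *: Phi u) /\
      (forall v, Phi (e v) = e' v) }.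
End InducedFrom.

Section Standard.
Variables (F : fieldType) (n : nat) (kappa : F).
Variables (d : nat) (rE : mx_representation F [set: 'S_n] d).
Local Notation H := (rat_cherednik n kappa).
Local Notation Ht := (trig_cherednik n kappa).
Local Notation rW := (@rW F n kappa).
Local Notation rY := (@rY F n kappa).
Local Notation tW := (@tW F n kappa).
Local Notation tU := (@tU F n kappa).
Local Notation rat_const := (pres_const (@rat_rel F n kappa)).
Local Notation trig_const := (pres_const (@trig_rel F n kappa)).
Local Notation Dr := (rat_standard kappa rE).
Local Notation Dt := (trig_standard kappa rE).

Lemma phi_ring b a : phi_gen (kappa := kappa) b a ->
  (a \in group_ring F [set: 'S_n])%MS.
Proof. by case=> [s|i]; rewrite ?envelop_mx_id ?inE // linear0 sub0mx. Qed.

Lemma psi_ring b a : psi_gen (kappa := kappa) b a ->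
  (a \in group_ring F [set: 'S_n])%MS.
Proof.
case=> [s|i]; first by rewrite envelop_mx_id ?inE.
by rewrite linear_sum summx_sub // => k _; rewrite envelop_mx_id ?inE.
Qed.

Lemma ex_rat_induced : exists e : {additive 'rV[F]_d -> Dr},
  rat_induced rE rat_const rW rY e.
Proof.
have [e eE] := ex_additive (@tensor1B F n _ _ d rE (phi_gen (kappa := kappa))).
exists e; split=> [c v|s v|i v|P P0 PD Pe|C phi Q e' e'Z e'W e'Y].
- by rewrite !eE tensor1Z.
- rewrite !eE; have g := hom_gen (phi_w kappa s).
  by rewrite (tensor1_act rE _ g) gring_opG ?inE.
- rewrite eE; have g := hom_gen (phi_y kappa i).
  by rewrite (tensor1_act rE _ g) linear0 mulmx0 -eE raddf0.
- apply: (@induced_ind _ _ _ _ _ rE (phi_gen (kappa := kappa)) P P0 PD) => h v.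
  by rewrite -eE; apply: Pe.
have [|b a v|Phi [PhiZ Phie]] := induced_univ phi_ring (phi := phi) (rE := rE) (e := e').
- exact: e'Z.
- case=> [s|i]; first by rewrite gring_opG ?inE //; apply: e'W.
  by rewrite linear0 mulmx0 raddf0; apply: e'Y.
by exists Phi; split=> // v; rewrite eE.
Qed.

Lemma ex_trig_induced : exists e : {additive 'rV[F]_d -> Dt},
  trig_induced rE trig_const tW tU e.
Proof.
have [e eE] := ex_additive (@tensor1B F n _ _ d rE (psi_gen (kappa := kappa))).
exists e; split=> [c v|s v|i v|P P0 PD Pe|Q e' e'Z e'W e'U].
- by rewrite !eE tensor1Z.
- rewrite !eE; have g := hom_gen (psi_w kappa s).
  by rewrite (tensor1_act rE _ g) gring_opG ?inE.
- rewrite !eE; have g := hom_gen (psi_u kappa i).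
  by rewrite (tensor1_act rE _ g) gring_op_jm.
- apply: (@induced_ind _ _ _ _ _ rE (psi_gen (kappa := kappa)) P P0 PD) => h v.
  by rewrite -eE; apply: Pe.
have [|b a v|Phi [PhiZ Phie]] := induced_univ psi_ring
    (phi := (@idfun Ht : {rmorphism Ht -> Ht})) (rE := rE) (e := e').
- exact: e'Z.
- case=> [s|i]; first by rewrite gring_opG ?inE //; apply: e'W.
  by rewrite gring_op_jm; apply: e'U.
by exists Phi; split=> // v; rewrite eE.
Qed.

End Standard.

Section StandardOverRings.
Variables (F : fieldType) (n d : nat) (rE : mx_representation F [set: 'S_n] d).
Variables (A B : pzRingType) (cA : {rmorphism F -> A}) (cB : {rmorphism F -> B}).
Variables (kappa : F) (x y : 'I_n -> A) (w : 'S_n -> A).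
Variables (X XV U : 'I_n -> B) (W : 'S_n -> B) (iota : {rmorphism A -> B}).
Local Notation u i := (x i * y i + jm w i).
Hypothesis indA : forall P : A -> Prop, (forall c, P (cA c)) ->
  (forall i, P (x i)) -> (forall s, P (w s)) -> (forall i, P (y i)) ->
  (forall a b, P a -> P b -> P (a + b)) ->
  (forall a b, P a -> P b -> P (a * b)) -> forall a, P a.
Hypotheses (ioX : forall i, iota (x i) = X i) (ioW : forall s, iota (w s) = W s)
  (ioU : forall i, iota (u i) = U i) (ioY : forall i, iota (y i) = XV i * (U i - jm W i))
  (ioC : forall c, iota (cA c) = cB c).
Hypothesis XVX : forall i, XV i * X i = 1.
Variables (M : lmodType A) (e : {additive 'rV[F]_d -> M}).
Hypothesis re : rat_induced rE cA w y e.

Section Comparison.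
Variables (V : lmodType B) (e' : {additive 'rV[F]_d -> V}).
Hypothesis ore : forall b k, exists k' a,
  iota (xfull x) ^+ k' * b = iota a * iota (xfull x) ^+ k.
Hypothesis te : trig_induced rE cB W U e'.
Hypothesis localization : exists (Q : lmodType B) (j : {additive M -> Q}),
  [/\ forall c m, j (cA c *: m) = cB c *: j m,
      forall i m, j (x i *: m) = X i *: j m,
      forall s m, j (w s *: m) = W s *: j m,
      forall i m, j (u i *: m) = U i *: j m &
      forall m, j m = 0 -> m = 0].

(** The map J from M to V is injective since, V being universal as well, the
    embedding of M into a B-module factors through it.  Every vector of V is a
    fraction because V is generated over B by the vectors e' v = J (e v). *)
Lemma ex_ore_pair : exists J : {additive M -> V}, ore_pair iota (xfull x) J.
Proof.
have [||i v|J [JZ Je]] := rat_ind_univ re (phi := iota) (e' := e').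
- by move=> c v; rewrite ioC (trig_ind_Z te).
- by move=> s v; rewrite ioW (trig_ind_w te).
- rewrite ioY -scalerA scalerBl (trig_ind_u te) (jm_act (trig_ind_w te)) subrr scaler0 //.
exists J; split=> // [m Jm0|v].
  (* Phi o J is the embedding j *)
  have [Q [j [jc jx jw ju jinj]]] := localization.
  have jZ := equivariant_gens (fun i => erefl (u i)) indA XVX ioX ioW ioU ioC jc jx jw ju.
  pose e1f v := j (e v).
  have [a b|e1 e1E] := @ex_additive _ _ e1f; first by rewrite /e1f !raddfB.
  have [c v|s v|i v|Phi [PhiZ Phie]] := trig_ind_univ te (e' := e1).
  - by rewrite !e1E /e1f (rat_ind_Z re) jc.
  - by rewrite !e1E /e1f -jw (rat_ind_w re).
  - rewrite !e1E /e1f -ju scalerDl -scalerA (rat_ind_y re) scaler0 add0r.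
    by rewrite (jm_act (rat_ind_w re)).
  apply: jinj; suff -> : j m = Phi (J m) by rewrite Jm0 raddf0.
  elim/(rat_ind_gen re): m {Jm0} => [|a b Ha Hb|h v]; first by rewrite !raddf0.
    by rewrite !raddfD Ha Hb.
  by rewrite JZ PhiZ Je Phie e1E jZ.
elim/(trig_ind_gen te): v => [|a b [k [m E]] [k' [m' E']]|h v].
- by exists 0%N, 0; rewrite scaler0 raddf0.
- exists (k + k')%N, (xfull x ^+ k' *: m + xfull x ^+ k *: m').
  by rewrite (raddfD J) !JZ !rmorphXn -E -E' !scalerA -!exprD (addnC k') -scalerDr.
have [k [a E]] := ore h 0; exists k, (a *: e v).
by rewrite scalerA E mulr1 JZ Je.
Qed.
End Comparison.

Hypothesis cAC : forall c a, cA c * a = a * cA c.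
Hypothesis rs : rat_sys (cA kappa) x w y.

Definition lowest (m : M) : Prop := exists v, m = e v.

Lemma lowest0 : lowest 0. Proof. by exists 0; rewrite raddf0. Qed.
Lemma lowestD a b : lowest a -> lowest b -> lowest (a + b).
Proof. by case=> v -> [v' ->]; exists (v + v'); rewrite raddfD. Qed.
Lemma lowest_c c m : lowest m -> lowest (cA c *: m).
Proof. by case=> v ->; exists (c *: v); rewrite (rat_ind_Z re). Qed.
Lemma lowest_w s m : lowest m -> lowest (w s *: m).
Proof. by case=> v ->; exists (v *m rE s); rewrite (rat_ind_w re). Qed.
Lemma lowest_y i m : lowest m -> y i *: m = 0.
Proof. by case=> v ->; apply: (rat_ind_y re). Qed.
Lemma lowest_gen (P : M -> Prop) : P 0 -> (forall a b, P a -> P b -> P (a + b)) ->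
  (forall h v, lowest v -> P (h *: v)) -> forall m, P m.
Proof. by move=> P0 PD Ph; apply: (rat_ind_gen re) => // h v; apply: Ph; exists v. Qed.

Lemma standard_nil (m : M) : exists K, (\sum_i y i) ^+ K *: m = 0.
Proof.
exact: (sum_y_nil cAC rs indA lowest_c lowest_w lowest_y lowest_gen).
Qed.

Hypothesis absE : mx_absolutely_irreducible rE.
Hypothesis kappa_nat : forall k, kappa *+ k.+1 != 0.

(** By Schur's lemma the sum of all transpositions acts as a scalar on E. *)
Lemma standard_sum_proper (K1 K2 : submodClosed M) :
  ~ (forall m, m \in K1) -> ~ (forall m, m \in K2) ->
  ~ (forall m, exists a b, [/\ a \in K1, b \in K2 & m = a + b]).
Proof.
have /is_scalar_mxP[c0 c0E] := mx_abs_irr_cent_scalar absE (sum_jm_cent rE).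
have lowest_jm m : lowest m -> (\sum_i jm w i) *: m = cA c0 *: m.
  case=> v ->; rewrite scaler_suml -(rat_ind_Z re) -mul_mx_scalar -c0E.
  rewrite mulmx_sumr raddf_sum.
  by apply: eq_bigr => i _; apply: (jm_act (rat_ind_w re)).
have irr (K : submodClosed M) m : lowest m -> m != 0 -> m \in K ->
    forall m', lowest m' -> m' \in K.
  case=> v -> v0 Kv _ [v' ->].
  have v_neq0 : v != 0 by apply: contra_neq v0 => ->; rewrite raddf0.
  have := mxsimple_cyclic (mx_abs_irrW absE) v_neq0 (submx1 v).
  case/eqmxP/andP=> /(submx_trans (submx1 v'))/cyclic_mxP[a Ea ->] _.
  have /envelop_mxP[c ->] := Ea; rewrite mulmx_sumr raddf_sum.
  elim/big_ind: _ => [|m1 m2|s _]; first exact: submod0; first exact: submodD.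
  by rewrite -scalemxAr /= (rat_ind_Z re) -(rat_ind_w re); do 2!apply: submodZ.
exact: (sum_proper cAC rs indA lowest0 lowestD lowest_c lowest_w lowest_y lowest_jm
  lowest_gen (cAC kappa) kappa_nat irr).
Qed.
End StandardOverRings.

(** * The comparison of multiplicities *)
Section StandardPair.
Variables (F : closedFieldType) (n : nat) (kappa : F).
Hypotheses (charF0 : [pchar F] =i pred0) (kappa_neq0 : kappa != 0).
Variables (d : nat) (rE : mx_representation F [set: 'S_n] d).
Hypothesis irrE : mx_irreducible rE.
Local Notation H := (rat_cherednik n kappa).
Local Notation Ht := (trig_cherednik n kappa).
Variable iota : {rmorphism H -> Ht}.
Hypothesis io : is_iota iota.
Local Notation Dr := (rat_standard kappa rE).
Local Notation Dt := (trig_standard kappa rE).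

Lemma rat_standard_nil : nilmod (rat_Y n kappa) Dr.
Proof.
have [e re] := ex_rat_induced kappa rE.
exact: (standard_nil (@rat_alg_ind F n kappa) re
  (@pres_constC _ _ (@rat_rel F n kappa)) (@rat_alg_sys F n kappa)).
Qed.

Lemma rat_standard_sum (K1 K2 : submodClosed Dr) :
  ~ (forall m, m \in K1) -> ~ (forall m, m \in K2) ->
  ~ (forall m, exists a b, [/\ a \in K1, b \in K2 & m = a + b]).
Proof.
have [e re] := ex_rat_induced kappa rE.
exact: (standard_sum_proper (@rat_alg_ind F n kappa) re
  (@pres_constC _ _ (@rat_rel F n kappa)) (@rat_alg_sys F n kappa)
  (group_closure_closed_field irrE) (kappa_nat charF0 kappa_neq0)).
Qed.

Lemma rat_p_inj (M : lmodType H) : nilmod (rat_Y n kappa) M ->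
  forall m : M, xfull (@rX F n kappa) *: m = 0 -> m = 0.
Proof.
move=> nilM m pm; have [K Km] := nilM m.
apply: (@saturating_rat F n kappa charF0 kappa_neq0 H (@idfun H : {rmorphism H -> H})
  M (fun v => v = 0) _ _ m K 1 Km).
- by move=> u v -> ->; rewrite subr0.
- by move=> a v ->; rewrite scaler0.
by rewrite expr1.
Qed.

Lemma standard_ore_pair : exists J : {additive Dr -> Dt}, ore_pair iota (rat_p n kappa) J.
Proof.
have [e re] := ex_rat_induced kappa rE.
have [e' te] := ex_trig_induced kappa rE.
have loc := ex_localization (@pres_constC _ _ (@rat_rel F n kappa)) (@rU_sys F n kappa)
  (rat_p_inj rat_standard_nil).
exact: (ex_ore_pair (@rat_alg_ind F n kappa) (iotaX io) (iotaW io) (iota_u io) (iotaY io)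
  (iotaC io) (@tXVX F n kappa) re (ore_iota io)
  te loc).
Qed.
End StandardPair.

Theorem corollary6p3 (F : closedFieldType) (charF0 : [pchar F] =i pred0)
    (n : nat) (n_ge2 : (2 <= n)%N) (kappa : F) (kappa_neq0 : kappa != 0)
    (dE dE' : nat)
    (E : mx_representation F [set: 'S_n] dE)
    (E' : mx_representation F [set: 'S_n] dE')
    (irrE : mx_irreducible E) (irrE' : mx_irreducible E')
    (L : lmodType (rat_cherednik n kappa))
    (Lt : lmodType (trig_cherednik n kappa))
    (hL : simple_quotient (rat_standard kappa E') L)
    (hLt : simple_quotient (trig_standard kappa E') Lt) :
  multiplicity (rat_standard kappa E) L =
  multiplicity (trig_standard kappa E) Lt.
Proof.
have [iota io] := ex_iota n kappa.
have [pV [pVp ppV]] := ex_pV io.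
have ore := ore_iota io.
have satA := @saturating_rat F n kappa charF0 kappa_neq0 _
  (@idfun _ : {rmorphism _ -> _}).
have satB := @saturating_rat F n kappa charF0 kappa_neq0 _ iota.
have [J JP] := standard_ore_pair charF0 kappa_neq0 E io.
have [J' JP'] := standard_ore_pair charF0 kappa_neq0 E' io.
have [[jL jLP] nilL] := ore_simple_quotient pVp ore satA JP'
  (@rat_standard_nil _ _ _ _ _)
  (@rat_standard_sum _ _ _ charF0 kappa_neq0 _ _ irrE') hL hLt.
exact: (ore_multiplicity pVp ppV ore satA satB JP (@rat_standard_nil _ _ _ _ _) jLP nilL).
Qed.
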